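(* Let $\mathcal{D}=(\mathcal{P},\mathcal{B})$ be a non-trivial $2$-$(36,6,\lambda)$ design, and let $G\le\mathrm{Aut}(\mathcal{D})$ be block-transitive with $PSL(2,8)\unlhd G\le P\Gamma L(2,8)$. Then one of the following holds: (1) $G=PSL(2,8)$, $\lambda\in\{2,6,12\}$, and $\mathcal{D}$ is, up to isomorphism, one of the $46$ designs of List I; (2) $G=P\Gamma L(2,8)$, $\lambda\in\{2,6,9,12,18,36\}$, and $\mathcal{D}$ is, up to isomorphism, one of the $330$ designs of List II. (List I and List II are the explicit lists of designs given in the context.)
   Context: A $2$-$(v,k,\lambda)$ design is a pair $\mathcal{D}=(\mathcal{P},\mathcal{B})$ with $\mathcal{P}$ a set of $v$ points and $\mathcal{B}$ a collection of $k$-element subsets of $\mathcal{P}$ (blocks) such that every $2$-element subset of $\mathcal{P}$ lies in exactly $\lambda$ blocks; it is non-trivial if $2<k<v$. $\mathrm{Aut}(\mathcal{D})$ is the group of permutations of $\mathcal{P}$ preserving $\mathcal{B}$; $G\le\mathrm{Aut}(\mathcal{D})$ is block-transitive if it is transitive on $\mathcal{B}$. $P\Gamma L(2,8)=\mathrm{Aut}(PSL(2,8))$. For a permutation group $H$ on $\{1,\dots,36\}$ and a $6$-subset $B$ (a base block), the associated incidence structure is $(\{1,\dots,36\},B^{H})$, where $B^H$ is the $H$-orbit of $B$. Shorthand for lists of base blocks: an entry $[a;\,b:c_1,c_2,\dots]$ stands for the sets $\{1,2,3,a,b,c_1\},\{1,2,3,a,b,c_2\},\dots$; within one bracket several groups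 ''$b:c_1,\dots$'' separated by ''|'' share the same $a$. **List I.** The designs $(\{1,\dots,36\},B^{H_1})$, where $H_1=\langle g_1,g_2\rangle\cong PSL(2,8)$ with $g_1=(2,3,5,8,13,20,29)(4,7,12,19,11,18,23)(6,10,16,25,28,14,22)(9,15,24,33,26,17,27)(21,31,32,34,36,35,30)$, $g_2=(1,2,4)(3,6,11)(5,9,7)(8,14,23)(10,17,28)(12,13,21)(15,24,34)(16,26,31)(18,29,33)(19,20,30)(22,32,36)(25,35,27)$, and $B$ is one of the following, with the indicated $\lambda$. $\lambda=2$: $\{1,2,4,16,26,31\}$. $\lambda=6$: $\{1,2,3,16,28,36\}$, $\{1,2,3,25,27,32\}$, $\{1,2,6,16,18,36\}$. $\lambda=12$ (42 base blocks): $\{1,2,6,7,15,17\}$ and [4; 15:16,27 | 16:24 | 22:34 | 24:27 | 25:34 | 26:35 | 31:34 | 32:34 | 34:36], [6; 12:25 | 15:23,32 | 17:36 | 24:26 | 26:36], [9; 10:27,32 | 11:17 | 12:17,34 | 16:32 | 17:18,30 | 18:22,25 | 22:27,34 | 25:34 | 28:35], [10; 12:24,25], [12; 14:22 | 17:35 | 32:34], [16; 24:30,32], [17; 24:35 | 25:31 | 30:31], [18; 30:31]. **List II.** The designs $(\{1,\dots,36\},B^{H_2})$, where $H_2=\langle h_1,h_2,h_3\rangle\cong P\Gamma L(2,8)$ with $h_1=(1,2,4,9,16,24,10)(3,7,6,13,11,19,18)(5,12,20,8,15,14,23)(17,25,22,28,21,29,27)(26,33,30,34,36,35,31)$, $h_2=(1,3,8)(2,5,6)(4,10,7)(9,17,26)(11,19,14)(12,21,30)(13,22,31)(15,23,16)(18,27,34)(20,28,33)(24,29,35)(25,32,36)$,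 $h_3=(1,3,8)(2,6,5)(4,11,15)(7,14,16)(9,18,12)(10,19,23)(13,20,24)(17,27,21)(22,28,29)(26,34,30)(31,33,35)$, and $B$ is one of the following, with the indicated $\lambda$. $\lambda=2$: $\{1,2,3,5,6,8\}$. $\lambda=6$: $\{1,2,3,4,27,30\}$, $\{1,2,3,5,9,29\}$, $\{1,2,3,10,27,28\}$, $\{1,2,3,15,22,27\}$. $\lambda=9$: $\{1,2,3,4,13,32\}$. $\lambda=12$: $\{1,2,3,11,17,22\}$, $\{1,2,3,12,15,19\}$, $\{1,2,3,13,26,30\}$, $\{1,2,7,9,25,26\}$. $\lambda=18$: $\{1,2,3,4,18,21\}$, $\{1,2,3,4,20,22\}$, $\{1,2,3,4,28,31\}$, $\{1,2,3,5,10,19\}$, $\{1,2,3,5,13,30\}$, $\{1,2,3,5,15,16\}$, $\{1,2,3,5,23,25\}$, $\{1,2,3,7,21,22\}$, $\{1,2,3,8,9,18\}$, $\{1,2,3,10,30,31\}$, $\{1,2,3,13,16,22\}$. $\lambda=36$ (309 base blocks): [4; 5:18,20,21,22,24,26,28,31,35 | 6:9,20,22,24,27,28,30,31,35 | 7:12,17,18,20,21,22,26,34,35 | 8:9,12,17,18,21,26,27,30,34 | 9:10,12,15,16,18,19,20,24,27 | 10:12,17,24,27,28,30,31,34 | 11:12,17,18,21,24,26,28,31,34 | 12:15,17,18,20,24,34 | 15:17,20,22,27,30,34,35 | 16:18,21,24,26,28,30,31 | 17:21,22,28,34 | 18:19,20,24,26 | 19:20,21,22,26,35 | 20:24,35 |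 21:22,27,28 | 22:28,35 | 24:31 | 25:33 | 26:31,34,35 | 31:34,35 | 34:35], [5; 6:9,12,13,17 | 9:10,12,15,16,18,19,20,24 | 10:13,20,26,30 | 12:13,16,19 | 13:15,16,18,19,20,24 | 15:18,21,24,30,31,33 | 17:19 | 19:30,31 | 23:32 | 26:30,33 | 30:31,34], [7; 8:12,17,25,32,34,36 | 9:12,16,21,25,26,36 | 11:12,25,34,36 | 12:19,24 | 13:16,22,25,26,35,36 | 14:25,32,34,36 | 15:17,25,32,34 | 16:20,24,29,31,33 | 17:19,27,28,29 | 18:26,27,28,30,31,33 | 19:20,21,22,34 | 20:27,29,31,33 | 21:24,30 | 22:31,33 | 24:26,36 | 25:27,28,29 | 26:27,35 | 27:32 | 28:32,35 | 29:32,35 | 30:34,36 | 31:32,36 | 32:33 | 33:34,36], [8; 9:28,31 | 10:17,25,32,36 | 12:13,24 | 13:26 | 18:33], [9; 11:12,21,25,28,31,36 | 12:20 | 13:16,19,26,31 | 14:16,19,28 | 17:23 | 20:36 | 23:34], [10; 11:12,25,34 | 12:13,15,16,20,23 | 13:19,28,30,31 | 15:34,36 | 16:27,30,34 | 17:23 | 19:22,33 | 22:24,25 | 23:25,32,34,36 | 33:34], [11; 12:20 | 14:25,32,34,36 | 17:29 | 20:36 | 22:25 | 29:32 | 34:35], [12; 13:25,36 | 15:18], [13; 16:18,24 | 18:30,35 | 19:20,31 | 20:26], [14; 18:32 | 19:20 | 20:36], [15; 17:29 | 19:30 | 20:35 | 29:35], [18; 26:30]. *)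

(* Defs.v *)
From HB Require Import structures.
From mathcomp Require Import all_boot all_order all_fingroup all_algebra all_solvable.

Set Implicit Arguments.
Unset Strict Implicit.
Unset Printing Implicit Defensive.

(** * The groups PSL(2,q) and PGammaL(2,q) *)

Section ProjectiveGroups.

Variable F : finFieldType.

Definition SL2 : {set {'GL_2[F]}} := [set g | (\det (GLval g) == 1)%R].

Lemma SL2_group_set : group_set SL2.
Proof.
apply/group_setP; split=> [|x y]; rewrite !inE.
  by rewrite GL_1E det1.
by rewrite GL_MxE det_mulmx => /eqP-> /eqP->; rewrite GRing.mulr1.
Qed.

Canonical SL2_group := Group SL2_group_set.

Definition PSL2 : {group coset_of 'Z(SL2)} := (SL2 / 'Z(SL2))%G.

Definition PGammaL2 : {group {perm coset_of 'Z(SL2)}} := [Aut PSL2]%G.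

(** The copy of PSL(2,q) inside PGammaL(2,q) = Aut(PSL(2,q)), i.e. the group of
    inner automorphisms. *)
Definition PSL2_in_PGammaL2 : {group {perm coset_of 'Z(SL2)}} :=
  (conj_aut PSL2 @* PSL2)%G.

End ProjectiveGroups.

(** * Designs *)

Section Designs.

Implicit Types T : finType.

Definition design T (v k lambda : nat) (B : {set {set T}}) : Prop :=
  [/\ #|T| = v,
      forall b : {set T}, b \in B -> #|b| = k
    & forall S : {set T}, #|S| = 2 -> #|[set b in B | S \subset b]| = lambda].

Definition nontrivial_design T (v k lambda : nat) (B : {set {set T}}) : Prop :=
  design v k lambda B /\ 2 < k < v.

Definition Aut_design T (B : {set {set T}}) : {group {perm T}} :=
  'N(B | 'P^*)%G.

Definition block_transitive T (G : {group {perm T}}) (B : {set {set T}}) : bool :=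
  [transitive G, on B | 'P^*].

Definition design_iso (T T' : finType) (B : {set {set T}}) (B' : {set {set T'}}) :
    Prop :=
  exists2 f : T -> T', bijective f & [set f @: (b : {set T}) | b in B] = B'.

Lemma Aut_designP T (B : {set {set T}}) (g : {perm T}) :
  reflect ([set g @: (b : {set T}) | b in B] = B) (g \in Aut_design B).
Proof.
have injg : injective (fun b : {set T} => g @: b) by apply: imset_inj perm_inj.
have gE (b : {set T}) : setact 'P%act b g = g @: b by [].
apply: (iffP astabsP) => [gB | gB b].
  apply/eqP; rewrite eqEcard card_imset // leqnn andbT.
  by apply/subsetP=> _ /imsetP[b Bb ->]; have := gB b; rewrite /= gE Bb.
by rewrite /= gE -{1}gB (mem_imset _ _ injg).
Qed.

End Designs.

(** * Permutations and blocks on {1, ..., 36}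

    The point set {1, ..., 36} is ['I_36], the point [n] being the ordinal of
    value [n - 1]. *)

Definition pt (n : nat) : 'I_36 := inord n.-1.

(** Permutations are composed from left to right in MathComp, so this product of
    transpositions is the cycle (a, b1, b2, ..., br); see [cycE]. *)
Definition cyc (T : finType) (s : seq T) : {perm T} :=
  if s is a :: s' then (\prod_(b <- s') tperm a b)%g else 1%g.

Lemma cycE (T : finType) (s : seq T) (x : T) : uniq s -> cyc s x = next s x.
Proof.
case: s => [|a s] /=; first by rewrite perm1.
elim/last_ind: s x => [|s b IHs] x.
  by rewrite big_nil perm1 /=; case: eqP.
rewrite mem_rcons inE negb_or rcons_uniq => /and3P[/andP[neq_ab s'a] s'b Us].
have Uas : (a \notin s) && uniq s by rewrite s'a Us.
rewrite -cats1 big_cat big_seq1 /= permM IHs // -[next_at x a a s]/(next (a :: s) x).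
rewrite -[next_at _ _ _ _]/(next (a :: s ++ [:: b]) x).
have Hc : a :: s ++ [:: b] = rcons (a :: s) b by rewrite -cats1.
have Uasb : uniq (a :: s ++ [:: b]).
  by rewrite Hc rcons_uniq inE negb_or eq_sym neq_ab s'b /= s'a.
have nextN (t : seq T) y : y \notin t -> next t y = y.
  by move=> t'y; rewrite next_nth (negPf t'y).
have [<-{x}|neq_xb] := eqVneq b x.
  rewrite (@nextN (a :: s) b) ?inE ?negb_or 1?eq_sym ?neq_ab // tpermR.
  have: next (a :: s ++ [:: b]) (last a (s ++ [:: b])) = a.
    have := next_nth (a :: s ++ [:: b]) (last a (s ++ [:: b])).
    rewrite mem_last index_last // => ->.
    by rewrite nth_default.
  by rewrite cats1 last_rcons => ->.
have [xs|xs'] := boolP (x \in a :: s); last first.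
  rewrite (@nextN (a :: s)) // nextN; last first.
    by rewrite Hc mem_rcons inE negb_or xs' andbT eq_sym.
  by rewrite tpermD // ?[b == _]negPf //; move: xs'; rewrite inE negb_or eq_sym => /andP[].
have Hn : next (a :: s ++ [:: b]) x = nth a (s ++ [:: b]) (index x (a :: s)).
  rewrite next_nth Hc mem_rcons inE xs orbT -cats1 index_cat xs.
  by rewrite cats1.
rewrite Hn next_nth xs nth_cat.
have := xs; rewrite -index_mem /= ltnS leq_eqVlt => /orP[/eqP iE|lti].
  by rewrite iE ltnn subnn /= nth_default // tpermL.
rewrite lti tpermD //.
  by apply: contraNneq s'a => ->; apply: mem_nth.
by apply: contraNneq s'b => ->; apply: mem_nth.
Qed.

Definition perm_of_cycles (cs : seq (seq nat)) : {perm 'I_36} :=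
  (\prod_(c <- cs) cyc (map pt c))%g.

Definition block (s : seq nat) : {set 'I_36} := [set:: map pt s].

Definition orbit_design (H : {group {perm 'I_36}}) (s : seq nat) : {set {set 'I_36}} :=
  orbit 'P^* H (block s).

(** The bracket [a; b : c1, c2, ... | b' : c1', ... | ...] is encoded as
    [(a, [:: (b, [:: c1; c2; ...]); (b', [:: c1'; ...]); ...])]. *)
Definition expand (br : seq (nat * seq (nat * seq nat))) : seq (seq nat) :=
  flatten [seq flatten [seq [seq [:: 1; 2; 3; e.1; g.1; c] | c <- g.2] | g <- e.2]
          | e <- br].

Definition with_lambda (lambda : nat) (bs : seq (seq nat)) : seq (nat * seq nat) :=
  [seq (lambda, b) | b <- bs].

(** * The two lists of designs

    The members of [list_I] and [list_II] are pairs made of a value of lambda and a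
    base block. *)

Definition g1 : {perm 'I_36} := perm_of_cycles
  [:: [:: 2; 3; 5; 8; 13; 20; 29];
      [:: 4; 7; 12; 19; 11; 18; 23];
      [:: 6; 10; 16; 25; 28; 14; 22];
      [:: 9; 15; 24; 33; 26; 17; 27];
      [:: 21; 31; 32; 34; 36; 35; 30]].

Definition g2 : {perm 'I_36} := perm_of_cycles
  [:: [:: 1; 2; 4];
      [:: 3; 6; 11];
      [:: 5; 9; 7];
      [:: 8; 14; 23];
      [:: 10; 17; 28];
      [:: 12; 13; 21];
      [:: 15; 24; 34];
      [:: 16; 26; 31];
      [:: 18; 29; 33];
      [:: 19; 20; 30];
      [:: 22; 32; 36];
      [:: 25; 35; 27]].

Definition H1 : {group {perm 'I_36}} := <<[set g1; g2]>>%G.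

Definition list_I_2 : seq (seq nat) :=
  [:: [:: 1; 2; 4; 16; 26; 31]].

Definition list_I_6 : seq (seq nat) :=
  [:: [:: 1; 2; 3; 16; 28; 36];
      [:: 1; 2; 3; 25; 27; 32];
      [:: 1; 2; 6; 16; 18; 36]].

Definition list_I_12 : seq (seq nat) :=
  [:: [:: 1; 2; 6; 7; 15; 17]] ++
  expand
  [:: (4, [:: (15, [:: 16; 27]); (16, [:: 24]); (22, [:: 34]); (24, [:: 27]);
           (25, [:: 34]); (26, [:: 35]); (31, [:: 34]); (32, [:: 34]);
           (34, [:: 36])]);
      (6, [:: (12, [:: 25]); (15, [:: 23; 32]); (17, [:: 36]); (24, [:: 26]);
           (26, [:: 36])]);
      (9, [:: (10, [:: 27; 32]); (11, [:: 17]); (12, [:: 17; 34]); (16, [:: 32]);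
           (17, [:: 18; 30]); (18, [:: 22; 25]); (22, [:: 27; 34]); (25, [:: 34]);
           (28, [:: 35])]);
      (10, [:: (12, [:: 24; 25])]);
      (12, [:: (14, [:: 22]); (17, [:: 35]); (32, [:: 34])]);
      (16, [:: (24, [:: 30; 32])]);
      (17, [:: (24, [:: 35]); (25, [:: 31]); (30, [:: 31])]);
      (18, [:: (30, [:: 31])])].

Definition list_I : seq (nat * seq nat) :=
  with_lambda 2 list_I_2 ++
  with_lambda 6 list_I_6 ++
  with_lambda 12 list_I_12.

Lemma size_list_I : size list_I = 46.
Proof. by []. Qed.

Definition h1 : {perm 'I_36} := perm_of_cycles
  [:: [:: 1; 2; 4; 9; 16; 24; 10];
      [:: 3; 7; 6; 13; 11; 19; 18];
      [:: 5; 12; 20; 8; 15; 14; 23];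
      [:: 17; 25; 22; 28; 21; 29; 27];
      [:: 26; 33; 30; 34; 36; 35; 31]].

Definition h2 : {perm 'I_36} := perm_of_cycles
  [:: [:: 1; 3; 8];
      [:: 2; 5; 6];
      [:: 4; 10; 7];
      [:: 9; 17; 26];
      [:: 11; 19; 14];
      [:: 12; 21; 30];
      [:: 13; 22; 31];
      [:: 15; 23; 16];
      [:: 18; 27; 34];
      [:: 20; 28; 33];
      [:: 24; 29; 35];
      [:: 25; 32; 36]].

Definition h3 : {perm 'I_36} := perm_of_cycles
  [:: [:: 1; 3; 8];
      [:: 2; 6; 5];
      [:: 4; 11; 15];
      [:: 7; 14; 16];
      [:: 9; 18; 12];
      [:: 10; 19; 23];
      [:: 13; 20; 24];
      [:: 17; 27; 21];
      [:: 22; 28; 29];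
      [:: 26; 34; 30];
      [:: 31; 33; 35]].

Definition H2 : {group {perm 'I_36}} := <<[set h1; h2; h3]>>%G.

Definition list_II_2 : seq (seq nat) :=
  [:: [:: 1; 2; 3; 5; 6; 8]].

Definition list_II_6 : seq (seq nat) :=
  [:: [:: 1; 2; 3; 4; 27; 30];
      [:: 1; 2; 3; 5; 9; 29];
      [:: 1; 2; 3; 10; 27; 28];
      [:: 1; 2; 3; 15; 22; 27]].

Definition list_II_9 : seq (seq nat) :=
  [:: [:: 1; 2; 3; 4; 13; 32]].

Definition list_II_12 : seq (seq nat) :=
  [:: [:: 1; 2; 3; 11; 17; 22];
      [:: 1; 2; 3; 12; 15; 19];
      [:: 1; 2; 3; 13; 26; 30];
      [:: 1; 2; 7; 9; 25; 26]].

Definition list_II_18 : seq (seq nat) :=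
  [:: [:: 1; 2; 3; 4; 18; 21];
      [:: 1; 2; 3; 4; 20; 22];
      [:: 1; 2; 3; 4; 28; 31];
      [:: 1; 2; 3; 5; 10; 19];
      [:: 1; 2; 3; 5; 13; 30];
      [:: 1; 2; 3; 5; 15; 16];
      [:: 1; 2; 3; 5; 23; 25];
      [:: 1; 2; 3; 7; 21; 22];
      [:: 1; 2; 3; 8; 9; 18];
      [:: 1; 2; 3; 10; 30; 31];
      [:: 1; 2; 3; 13; 16; 22]].

Definition list_II_36 : seq (seq nat) :=
  expand
  [:: (4, [:: (5, [:: 18; 20; 21; 22; 24; 26; 28; 31; 35]);
           (6, [:: 9; 20; 22; 24; 27; 28; 30; 31; 35]);
           (7, [:: 12; 17; 18; 20; 21; 22; 26; 34; 35]);
           (8, [:: 9; 12; 17; 18; 21; 26; 27; 30; 34]);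
           (9, [:: 10; 12; 15; 16; 18; 19; 20; 24; 27]);
           (10, [:: 12; 17; 24; 27; 28; 30; 31; 34]);
           (11, [:: 12; 17; 18; 21; 24; 26; 28; 31; 34]);
           (12, [:: 15; 17; 18; 20; 24; 34]);
           (15, [:: 17; 20; 22; 27; 30; 34; 35]);
           (16, [:: 18; 21; 24; 26; 28; 30; 31]); (17, [:: 21; 22; 28; 34]);
           (18, [:: 19; 20; 24; 26]); (19, [:: 20; 21; 22; 26; 35]);
           (20, [:: 24; 35]); (21, [:: 22; 27; 28]); (22, [:: 28; 35]);
           (24, [:: 31]); (25, [:: 33]); (26, [:: 31; 34; 35]); (31, [:: 34; 35]);
           (34, [:: 35])]);
      (5, [:: (6, [:: 9; 12; 13; 17]); (9, [:: 10; 12; 15; 16; 18; 19; 20; 24]);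
           (10, [:: 13; 20; 26; 30]); (12, [:: 13; 16; 19]);
           (13, [:: 15; 16; 18; 19; 20; 24]); (15, [:: 18; 21; 24; 30; 31; 33]);
           (17, [:: 19]); (19, [:: 30; 31]); (23, [:: 32]); (26, [:: 30; 33]);
           (30, [:: 31; 34])]);
      (7, [:: (8, [:: 12; 17; 25; 32; 34; 36]); (9, [:: 12; 16; 21; 25; 26; 36]);
           (11, [:: 12; 25; 34; 36]); (12, [:: 19; 24]);
           (13, [:: 16; 22; 25; 26; 35; 36]); (14, [:: 25; 32; 34; 36]);
           (15, [:: 17; 25; 32; 34]); (16, [:: 20; 24; 29; 31; 33]);
           (17, [:: 19; 27; 28; 29]); (18, [:: 26; 27; 28; 30; 31; 33]);
           (19, [:: 20; 21; 22; 34]); (20, [:: 27; 29; 31; 33]); (21, [:: 24; 30]);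
           (22, [:: 31; 33]); (24, [:: 26; 36]); (25, [:: 27; 28; 29]);
           (26, [:: 27; 35]); (27, [:: 32]); (28, [:: 32; 35]); (29, [:: 32; 35]);
           (30, [:: 34; 36]); (31, [:: 32; 36]); (32, [:: 33]); (33, [:: 34; 36])]);
      (8, [:: (9, [:: 28; 31]); (10, [:: 17; 25; 32; 36]); (12, [:: 13; 24]);
           (13, [:: 26]); (18, [:: 33])]);
      (9, [:: (11, [:: 12; 21; 25; 28; 31; 36]); (12, [:: 20]);
           (13, [:: 16; 19; 26; 31]); (14, [:: 16; 19; 28]); (17, [:: 23]);
           (20, [:: 36]); (23, [:: 34])]);
      (10, [:: (11, [:: 12; 25; 34]); (12, [:: 13; 15; 16; 20; 23]);
           (13, [:: 19; 28; 30; 31]); (15, [:: 34; 36]); (16, [:: 27; 30; 34]);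
           (17, [:: 23]); (19, [:: 22; 33]); (22, [:: 24; 25]);
           (23, [:: 25; 32; 34; 36]); (33, [:: 34])]);
      (11, [:: (12, [:: 20]); (14, [:: 25; 32; 34; 36]); (17, [:: 29]); (20, [:: 36]);
           (22, [:: 25]); (29, [:: 32]); (34, [:: 35])]);
      (12, [:: (13, [:: 25; 36]); (15, [:: 18])]);
      (13, [:: (16, [:: 18; 24]); (18, [:: 30; 35]); (19, [:: 20; 31]); (20, [:: 26])]);
      (14, [:: (18, [:: 32]); (19, [:: 20]); (20, [:: 36])]);
      (15, [:: (17, [:: 29]); (19, [:: 30]); (20, [:: 35]); (29, [:: 35])]);
      (18, [:: (26, [:: 30])])].

Definition list_II : seq (nat * seq nat) :=
  with_lambda 2 list_II_2 ++
  with_lambda 6 list_II_6 ++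
  with_lambda 9 list_II_9 ++
  with_lambda 12 list_II_12 ++
  with_lambda 18 list_II_18 ++
  with_lambda 36 list_II_36.

Lemma size_list_II : size list_II = 330.
Proof. by []. Qed.

(* Main.v *)
Require Import Defs.
From HB Require Import structures.
From mathcomp Require Import all_boot all_order all_fingroup all_algebra all_solvable.
From mathcomp Require Import all_field.
From mathcomp Require Import ring zify.

Set Implicit Arguments.
Unset Strict Implicit.
Unset Printing Implicit Defensive.

(** Block transitivity forces [G] to be transitive on the 36 points
    ([design36_transitive]), so the point stabilisers have order 14 or 42.  Such a
    stabiliser has a normal Sylow 7-subgroup, and this determines the action: two
    transitive actions of [G] of degree 36 are equivalent as soon as an element of order
    7 has a single fixed point in one of them ([equivariant_bijection]).  It remains to
    find [G] as an abstract group and to list the designs for one action of it.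

    The group [H2] on 36 points has a normal subgroup [K2] of order 504.  A list of 504
    pairs made of a matrix and of a permutation is closed under multiplication and is
    the graph of an isomorphism of SL(2,8) with [K2] ([K2_isog_SL2]).  An automorphism
    of [K2] is determined by the images of two generators of orders 2 and 3 whose product
    has order 7, and there are 1512 such pairs in [K2]; as [H2] has order 1512 and acts
    faithfully on [K2] by conjugation, it is the whole automorphism group
    ([H2_isog_Aut]).  Since the index is 3, the group [G] is isomorphic to [K2] or to
    [H2] ([PSL2_PGammaL2_cases]), and the design can be carried over to a design on which
    [K2] or [H2] acts ([transport_design]).

    A weight on pairs of points that is invariant under the group has the same total on
    all blocks, and the design property prescribes this total ([design36_weight]).  Since
    [lambda] is positive, some block contains the points 1 and 2.  An exhaustive search
    through the sets of six points that contain these two and have the right total finds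
    only images under [H2] of the base blocks in the lists ([classification]).  Those of
    the first list are first moved from [H1] to [K2] by a permutation that conjugates one
    group to the other.  Finally [lambda] is the number of images of a base block under
    the group that contain the points 1 and 2. *)

(** * Block-transitive designs *)

Local Open Scope group_scope.

Lemma block_transitive_image (T : finType) (G : {group {perm T}})
    (B : {set {set T}}) (b c : {set T}) :
  block_transitive G B -> b \in B -> c \in B ->
  exists2 g : {perm T}, g \in G & c = g @: b.
Proof.
move=> trG Bb; rewrite -(atransP trG b Bb).
by case/orbitP=> g Gg <-; exists g.
Qed.

Lemma block_transitive_orbit (T : finType) (G : {group {perm T}})
    (B : {set {set T}}) (b : {set T}) :
  block_transitive G B -> b \in B -> B = orbit 'P^* G b.
Proof. by move=> trG Bb; rewrite (atransP trG). Qed.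

(** Double counting: summing an invariant weight over the ordered pairs of points
    that lie in a block gives the same value for every block, and every ordered pair
    is counted [lambda] times in all. *)
Lemma design_weight (T : finType) v k lambda (B : {set {set T}})
    (G : {group {perm T}}) (w : T -> T -> nat) (b : {set T}) :
    design v k lambda B -> block_transitive G B ->
    {in G, forall g x y, w ((g : {perm T}) x) (g y) = w x y} -> b \in B ->
  (#|B| * (\sum_(x in b) \sum_(y in b | y != x) w x y)
     = lambda * \sum_x \sum_(y | y != x) w x y)%N.
Proof.
move=> [_ _ lamB] trG wG Bb.
pose s (c : {set T}) := (\sum_(x in c) \sum_(y in c | y != x) w x y)%N.
pose P (c : {set T}) (p : T * T) := [&& p.1 \in c, p.2 \in c & p.2 != p.1].
have sE c : s c = (\sum_(p | P c p) w p.1 p.2)%N by rewrite /s pair_big_dep.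
have sG g : g \in G -> s (g @: b) = s b.
  move=> Gg; rewrite !sE (reindex_inj (h := fun p => (g p.1, g p.2))) /=; last first.
    by move=> [x y] [x' y'] /= [/perm_inj-> /perm_inj->].
  apply: eq_big => [[x y]|[x y] _]; last by rewrite /= wG.
  by rewrite /P /= !(mem_imset _ _ (@perm_inj _ _)) (inj_eq perm_inj).
transitivity (\sum_(c in B) s c)%N.
  rewrite -sum_nat_const; apply: eq_bigr => c Bc.
  by have [g Gg ->] := block_transitive_image trG Bb Bc; rewrite sG.
under eq_bigr do rewrite sE.
rewrite [in RHS]pair_big_dep big_distrr /=.
rewrite (exchange_big_dep (fun p : T * T => p.2 != p.1)) /=; last first.
  by move=> c p _ /and3P[].
apply: eq_bigr => -[x y] /= y'x.
have yx2 : #|[set x; y]| = 2 by rewrite cards2 eq_sym y'x.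
rewrite sum_nat_const -(lamB _ yx2); congr (_ * _)%N; apply: eq_card => c.
by rewrite !inE subUset !sub1set /P /= ?y'x unfold_in /= andbT.
Qed.

Section Design36.

Variables (T : finType) (lambda : nat) (B : {set {set T}}).
Variable G : {group {perm T}}.
Hypotheses (desB : design 36 6 lambda B) (trG : block_transitive G B).

Lemma block_exists : exists b, b \in B.
Proof. by case/imsetP: trG => b Bb _; exists b. Qed.

Lemma sum_offdiag (b : {set T}) (f : T -> nat) :
  (\sum_(x in b) \sum_(y in b | y != x) f x = \sum_(x in b) f x * #|b|.-1)%N.
Proof.
apply: eq_bigr => x bx; rewrite sum_nat_const mulnC; congr (_ * _)%N.
rewrite (cardsD1 x) bx /= -cardsE; congr #|pred_of_set _|.
by apply/setP => y; rewrite !inE andbC.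
Qed.

Lemma sum_offdiagT (f : T -> nat) :
  (\sum_x \sum_(y | y != x) f x = \sum_x f x * #|T|.-1)%N.
Proof.
have := sum_offdiag [set: T] f; rewrite cardsT.
rewrite big_mkcond [in RHS]big_mkcond.
under eq_bigr do rewrite in_setT; under [in RHS]eq_bigr do rewrite in_setT.
by move=> <-; apply: eq_bigr => x _; apply: eq_bigl => y; rewrite in_setT.
Qed.

Lemma design_lambda_gt0 : 0 < lambda.
Proof.
have [[_ cB lamB] [b Bb]] := (desB, block_exists).
have: 1 < #|b| by rewrite cB.
case/card_gt1P=> x [y [bx by_ xy]].
have xy2 : #|[set x; y]| = 2 by rewrite cards2 xy.
rewrite -(lamB _ xy2); apply/card_gt0P; exists b.
by rewrite inE Bb subUset !sub1set bx.
Qed.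

Lemma design_card_blocks : #|B| = (42 * lambda)%N.
Proof.
have [[cT cB _] [b Bb]] := (desB, block_exists).
have := design_weight (w := fun _ _ => 1%N) desB trG (fun _ _ _ _ => erefl) Bb.
rewrite sum_offdiag sum_offdiagT cT (cB _ Bb) -!big_distrl /= !sum_nat_const.
rewrite cT (cB _ Bb); lia.
Qed.

(** The form in which [design_weight] is used: each invariant weight has a prescribed
    total on every block, namely 1/42 of its total on all ordered pairs. *)
Lemma design36_weight (w : T -> T -> nat) (b : {set T}) :
    {in G, forall g x y, w ((g : {perm T}) x) (g y) = w x y} -> b \in B ->
  (42 * (\sum_(x in b) \sum_(y in b | y != x) w x y)
     = \sum_x \sum_(y | y != x) w x y)%N.
Proof.
move=> wG Bb; have := design_weight desB trG wG Bb.
rewrite design_card_blocks => eqw.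
by apply/eqP; rewrite -(eqn_pmul2l design_lambda_gt0) -eqw; apply/eqP; lia.
Qed.

(** Block's lemma for these parameters.  A block meets a point orbit [O] in a number
    [j] of points that does not depend on the block; the weights [x \in O] and
    [(x \in O) && (y \in O)] give [#|O| = 6 * j] and [42 * j * (j - 1) = #|O| * (#|O| - 1)],
    whose only solution with [O] nonempty is [j = 6]. *)
Lemma design36_transitive : [transitive G, on [set: T] | 'P].
Proof.
have [[cT cB _] [b Bb]] := (desB, block_exists).
have : 0 < #|T| by rewrite cT.
case/card_gt0P=> t _; apply/imsetP; exists t => //.
apply/esym/eqP; rewrite eqEcard subsetT cardsT.
set O := orbit _ _ _; pose j := #|b :&: O|.
have OG : {in G, forall g x, ((g : {perm T}) x \in O) = (x \in O)}.
  by move=> g Gg x; rewrite /O -[g x]/('P%act x g) orbit_actr.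
have m_gt0 : 0 < #|O| by apply/card_gt0P; exists t; rewrite orbit_refl.
have sO (A : {set T}) : (\sum_(x in A) (x \in O) = #|A :&: O|)%N.
  rewrite -sum1_card big_mkcond [RHS]big_mkcond /=.
  by apply: eq_bigr => x _; rewrite inE; case: (x \in A); case: (x \in O).
have sOT : (\sum_x (x \in O) = #|O|)%N.
  by rewrite -[O in RHS]setTI -sO; apply: eq_bigl => x; rewrite inE.
have sO2 (A : {set T}) : (\sum_(x in A) \sum_(y in A | y != x) (x \in O) * (y \in O)
    = #|A :&: O| * #|A :&: O|.-1)%N.
  transitivity (\sum_(x in A :&: O) \sum_(y in A :&: O | y != x) 1)%N.
    rewrite big_mkcond [RHS]big_mkcond /=; apply: eq_bigr => x _; rewrite inE.
    case: (x \in A) => //=; case: (x \in O); last by rewrite big1.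
    rewrite big_mkcond [RHS]big_mkcond /=; apply: eq_bigr => y _; rewrite inE.
    by case: (y \in A); case: (y \in O); case: (y != x).
  by rewrite (sum_offdiag (A :&: O) (fun=> 1%N)) -big_distrl /= sum1_card.
have := @design36_weight (fun x y => (x \in O) : nat) b _ Bb.
rewrite sum_offdiag sum_offdiagT -!big_distrl /= sO sOT (cB _ Bb) cT => eq1.
have := design36_weight (w := fun x y => ((x \in O) * (y \in O))%N) (b := b) _ Bb.
have := sO2 [set: T]; rewrite setTI.
under eq_bigl do rewrite in_setT.
under eq_bigr do under eq_bigl do rewrite in_setT.
move=> -> /=; rewrite sO2 => eq2.
have {}eq1 : (42 * (j * 5) = #|O| * 35)%N by apply: eq1 => g Gg x _; rewrite OG.
have {}eq2 : (42 * (j * j.-1) = #|O| * #|O|.-1)%N.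
  by apply: eq2 => g Gg x y; rewrite !OG.
have Oj : #|O| = (6 * j)%N by lia.
by rewrite Oj; move: eq2 m_gt0; rewrite Oj; case: (j) => [|i]; nia.
Qed.

End Design36.

(** * Equivalence of two transitive actions *)

Lemma Sylow_normal_small (gT : finGroupType) (S : {group gT}) (p q : nat) :
    prime p -> 0 < q < p -> #|S| = (p * q)%N ->
  exists2 P : {group gT}, P <| S & #|P| = p.
Proof.
move=> p_pr /andP[q_gt0 q_ltp] oS.
have n1 : #|'Syl_p(S)| = 1%N.
  have := card_Syl_dvd p S; have := card_Syl_mod S p_pr.
  rewrite oS; set n := #|_| => n1 nd.
  have pn : coprime n p.
    rewrite coprime_sym prime_coprime // /dvdn n1; lia.
  rewrite (Gauss_dvdr _ pn) in nd.
  have nq : n <= q by apply: dvdn_leq.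
  by rewrite -n1 modn_small // (leq_ltn_trans nq).
have /normal_sylowP[P sylP nPS] : #|'Syl_p(S)| == 1%N by rewrite n1.
exists P => //; rewrite (card_Hall sylP) oS p_part lognM ?(prime_gt0 p_pr) //.
rewrite (logn_prime p p_pr) eqxx logn_coprime ?addn0 ?expn1 //.
by rewrite prime_coprime // gtnNdvd.
Qed.

Section Equivariant.

Variables (T T' : finType) (G : {group {perm T}}) (H : {group {perm T'}}).
Variables (phi : {morphism G >-> {perm T'}}) (p q : nat) (s : {perm T'}) (i0 : T').
Hypotheses (injphi : 'injm phi) (imphi : phi @* G = H).
Hypothesis trG : [transitive G, on [set: T] | 'P].
Hypothesis trH : [transitive H, on [set: T'] | 'P].
Hypotheses (p_pr : prime p) (q_ltp : 0 < q < p) (cT : #|T| = #|T'|).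
Hypotheses (oG : #|G| = (#|T| * (p * q))%N) (p'T : ~~ (p %| #|T|)).
Hypotheses (Hs : s \in H) (os : #[s] = p) (fixs : forall i, (s i == i) = (i == i0)).

(** The stabiliser of [t] in [G] has order [p * q] with [q < p], hence a normal
    subgroup of order [p].  Its image in [H] is a Sylow [p]-subgroup, conjugate to
    [<[s]>], so it has a single fixed point [j]; the image of the stabiliser normalises
    it and therefore fixes [j]. *)
Lemma stab_fix (t : T) :
  exists j : T', {in G, forall g : {perm T}, g t = t -> phi g j = j}.
Proof.
set S := 'C_G[t | 'P].
have oS : #|S| = (p * q)%N.
  have := card_orbit_in_stab 'P t (subsetT G).
  rewrite (atransP trG) ?inE // cardsT oG => /eqP.
  by rewrite eqn_pmul2l => [/eqP//|]; apply/card_gt0P; exists t.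
have [P /andP[sPS nPS] oP] := Sylow_normal_small (S := [group of S]) p_pr q_ltp oS.
have sSG : S \subset G by apply: subsetIl.
have sPG : P \subset G := subset_trans sPS sSG.
have oH : #|H| = (#|T| * (p * q))%N by rewrite -imphi card_injm.
have sylH (Q : {group {perm T'}}) : Q \subset H -> #|Q| = p -> p.-Sylow(H) Q.
  move=> sQH oQ; rewrite pHallE sQH oQ oH p_part.
  have /andP[q_gt0 qp] := q_ltp; have T_gt0 : 0 < #|T| by apply/card_gt0P; exists t.
  rewrite !lognM ?muln_gt0 ?(prime_gt0 p_pr) ?q_gt0 ?T_gt0 // (logn_prime p p_pr) eqxx.
  have copq : coprime p q by rewrite prime_coprime // gtnNdvd.
  have copT : coprime p #|T| by rewrite prime_coprime.
  by rewrite !logn_coprime // -[(_ + (_ + _))%N]/1%N expn1 eqxx.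
have [h Hh Eh] : exists2 h, h \in H & phi @* P = <[s]> :^ h.
  have syl1 : p.-Sylow(H) <[s]> by apply: sylH; rewrite /= ?cycle_subG -?orderE.
  have syl2 : p.-Sylow(H) (phi @* P).
    by apply: sylH; [rewrite /= -imphi morphimS | rewrite /= card_injm].
  by have [h Hh Eh] := Sylow_trans syl1 syl2; exists h.
have Ps : s ^ h \in phi @* P by rewrite Eh memJ_conjg cycle_id.
have fixP (i : T') : (s ^ h) i = i -> i = h i0.
  move=> fi; apply: (canRL (permKV h)); apply/eqP; rewrite -fixs; apply/eqP.
  by apply: (@perm_inj _ h); rewrite -permJ permKV.
have fixP' (Q : {perm T'}) : Q \in phi @* P -> Q (h i0) = h i0.
  rewrite Eh => /imsetP[r /cycleP[n ->] ->]; rewrite permJ; congr (h _).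
  have s0 : s i0 = i0 by apply/eqP; rewrite fixs.
  by elim: n => [|n IHn]; rewrite ?perm1 // expgSr permM IHn.
exists (h i0) => g Gg gt.
have Sg : g \in S by rewrite inE Gg; apply/astab1P.
apply: fixP.
have /morphimP[r Gr Pr Er] : (s ^ h) ^ (phi g)^-1 \in phi @* P.
  case/morphimP: Ps => r Gr Pr ->.
  have Prg : r ^ g^-1 \in P by rewrite memJ_norm // groupV (subsetP nPS).
  by rewrite -morphV // -morphJ ?groupV // mem_morphim // (subsetP sPG).
rewrite -[s ^ h](conjgKV (phi g)) permJ; congr (phi g _); apply: fixP'.
by rewrite Er mem_morphim.
Qed.

(** Two transitive actions of isomorphic groups of order [#|T| * (p * q)] are
    equivalent, as soon as some element of order [p] fixes exactly one point in one of
    them: the map [g t |-> phi g j] is well defined and onto. *)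
Lemma equivariant_bijection :
  exists2 f : T' -> T, bijective f &
    {in G, forall g : {perm T}, forall i, f (phi g i) = g (f i)}.
Proof.
have : 0 < #|T'| by apply/card_gt0P; exists i0.
rewrite -cT => /card_gt0P[t _].
have [j fixj] := stab_fix t.
have toT x : exists g, (g \in G) && (g t == x).
  have : x \in orbit 'P G t by rewrite (atransP trG) ?inE.
  by case/orbitP=> g Gg <-; exists g; rewrite Gg eqxx.
pose a x := xchoose (toT x).
have Ga x : a x \in G by have /andP[] := xchooseP (toT x).
have aE x : a x t = x by have /andP[_ /eqP] := xchooseP (toT x).
pose e x := phi (a x) j.
have eE : {in G, forall g : {perm T}, e (g t) = phi g j}.
  move=> g Gg; apply: (@perm_inj _ (phi (a (g t)))^-1).
  rewrite permK -permM -morphV // -morphM ?groupV // fixj ?groupM ?groupV //.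
  by rewrite permM; apply: (canLR (permK _)); rewrite aE.
have e_phi : {in G, forall g : {perm T}, forall x, e (g x) = phi g (e x)}.
  by move=> g Gg x; rewrite -[x in LHS]aE -permM eE ?groupM // morphM // permM.
have e_onto i : exists x, e x == i.
  have : i \in orbit 'P H j by rewrite (atransP trH) ?inE.
  rewrite -imphi => /orbitP[_ /morphimP[g _ Gg ->] <-].
  by exists (g t); rewrite eE.
pose f i := xchoose (e_onto i).
have fK : cancel f e by move=> i; apply/eqP/(xchooseP (e_onto i)).
have bijf : bijective f by apply: inj_card_bij (can_inj fK) _; rewrite cT.
have eK : cancel e f by apply/(bij_can_sym bijf).
by exists f => // g Gg i; rewrite -{1}[i]fK -e_phi // eK.
Qed.

End Equivariant.

(** * Words in two generators *)

Section Words.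

Variables (M : Type) (mul : M -> M -> M) (one : M).

(** The powers of [u] of exponents [0, ..., n - 1]. *)
Definition pow_list (u : M) (n : nat) : seq M := [seq iter i (mul u) one | i <- iota 0 n].

(** A list of words in [x] and [y].  When [x] and [y] generate PSL(2,8), with [x] of
    order 2, [y] of order 3 and [x * y] of order 7, as they do below, it runs once
    through the group: [c = x * y] and the involution [e] generate the stabiliser of a
    point of the projective line, of order 56, whose elements are the [c ^ i] and the
    [c ^ i * e * c ^ j]; and the element [z] of order 9 permutes the nine points of the
    line regularly.  The list makes sense for any binary operation, so that it can be
    evaluated on codes of group elements. *)
Definition psl_words (x y : M) : seq M :=
  let z := foldr mul one [:: x; y; x; y; y] in
  let e := foldr mul one [:: y; x; y; x; y; y; x; y; y] in
  let cs := pow_list (mul x y) 7 in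
  let borel := [seq mul u v | u <- cs, v <- one :: [seq mul e w | w <- cs]] in
  [seq mul u v | u <- pow_list z 9, v <- borel].

End Words.

Section WordsMorph.

Variables (M M' : Type) (mul : M -> M -> M) (one : M).
Variables (mul' : M' -> M' -> M') (one' : M') (f : M -> M').
Hypotheses (fM : forall u v, f (mul u v) = mul' (f u) (f v)) (f1 : f one = one').

Lemma map_pow_list u n : map f (pow_list mul one u n) = pow_list mul' one' (f u) n.
Proof.
rewrite /pow_list -map_comp; apply: eq_map => i /=.
by elim: i => //= i; rewrite fM => ->.
Qed.

Lemma foldr_morph s : f (foldr mul one s) = foldr mul' one' (map f s).
Proof. by elim: s => //= u s <-. Qed.

Lemma map_allpairs_morph us vs :
  map f [seq mul u v | u <- us, v <- vs] = [seq mul' u v | u <- map f us, v <- map f vs].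
Proof.
rewrite map_allpairs allpairs_mapl allpairs_mapr.
by elim: us => //= u us ->; congr (_ ++ _); apply: eq_map => v.
Qed.

Lemma map_psl_words x y :
  map f (psl_words mul one x y) = psl_words mul' one' (f x) (f y).
Proof.
have mapV e s : map f (one :: [seq mul e w | w <- s]) =
    one' :: [seq mul' (f e) w | w <- map f s].
  by rewrite /= f1 -!map_comp; congr (_ :: _); apply: eq_map => w; rewrite /= fM.
by rewrite /psl_words !map_allpairs_morph mapV !map_pow_list !foldr_morph fM.
Qed.

End WordsMorph.

(** * Tables of permutations *)

(** A permutation of ['I_36] as the list of its 36 values.  Points are numbered from 0
    here, so the point [n] of the lists of blocks has number [n - 1]. *)
Definition ptab (s : {perm 'I_36}) : seq nat := [seq val (s i) | i <- enum 'I_36].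
(** Composition of tables in the order of the product of permutations: first [t],
    then [u]. *)
Definition tcomp (t u : seq nat) : seq nat := [seq nth 0 u i | i <- t].
Definition tid : seq nat := iota 0 36.

Lemma nth_ptab s (i : 'I_36) : nth 0 (ptab s) i = s i.
Proof. by rewrite (nth_map i) ?size_enum_ord // nth_ord_enum. Qed.

Lemma ptab_inj : injective ptab.
Proof. by move=> s t eq_st; apply/permP => i; apply: val_inj; rewrite /= -!nth_ptab eq_st. Qed.

Lemma ptabM s t : ptab (s * t) = tcomp (ptab s) (ptab t).
Proof.
by rewrite /tcomp -map_comp; apply: eq_map => i; rewrite /= nth_ptab permM.
Qed.

Lemma ptab1 : ptab 1 = tid.
Proof. by rewrite /tid -val_enum_ord; apply: eq_map => i; rewrite perm1. Qed.

(** The tables of a cycle and of a product of cycles; the points in the cycles are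
    numbered from 1. *)
Definition cycle_tab (c : seq nat) : seq nat := [seq next (map predn c) i | i <- tid].
Definition cycles_tab (cs : seq (seq nat)) : seq nat := foldr tcomp tid (map cycle_tab cs).
Definition cycles_ok (cs : seq (seq nat)) : bool :=
  all (fun c => uniq (map predn c) && all (fun n => n.-1 < 36) c) cs.

Lemma val_pt n : n.-1 < 36 -> val (pt n) = n.-1.
Proof. by move=> n_lt; rewrite /= inordK. Qed.

Lemma ptab_cycles cs : cycles_ok cs -> ptab (perm_of_cycles cs) = cycles_tab cs.
Proof.
rewrite /perm_of_cycles; elim: cs => [|c cs IHcs]; first by rewrite big_nil ptab1.
move=> /= /andP[/andP[Uc c36] /IHcs {}IHcs]; rewrite big_cons ptabM IHcs.
congr (tcomp _ _).
have Ec : map predn c = map val (map pt c).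
  by rewrite -map_comp; apply/eq_in_map => n cn; rewrite [RHS]val_pt // (allP c36).
rewrite /cycle_tab Ec /tid -val_enum_ord -map_comp; apply: eq_map => i /=.
have Upc : uniq (map pt c) by rewrite -(map_inj_uniq val_inj) -Ec.
by rewrite cycE // (next_map val_inj).
Qed.

(** * Codes of the elements of SL(2,8) *)

(** The bits [(a0, a1, a2)] stand for [a0 + a1 * w + a2 * w ^ 2], where
    [w ^ 3 = w + 1]. *)
Definition f8 : Type := bool * bool * bool.
Definition f8add (a b : f8) : f8 :=
  let: (a0, a1, a2) := a in let: (b0, b1, b2) := b in
  (a0 (+) b0, a1 (+) b1, a2 (+) b2).
Definition f8mul (a b : f8) : f8 :=
  let: (a0, a1, a2) := a in let: (b0, b1, b2) := b in
  let c3 := (a1 && b2) (+) (a2 && b1) in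
  let c4 := a2 && b2 in
  ((a0 && b0) (+) c3, (a0 && b1) (+) (a1 && b0) (+) c3 (+) c4,
   (a0 && b2) (+) (a1 && b1) (+) (a2 && b0) (+) c4).
Definition f8zero : f8 := (false, false, false).
Definition f8one : f8 := (true, false, false).
(** Two by two matrices over the field with 8 elements, row by row. *)
Definition m8 : Type := f8 * f8 * (f8 * f8).
Definition m8mul (A B : m8) : m8 :=
  let: ((a, b), (c, d)) := A in let: ((a', b'), (c', d')) := B in
  ((f8add (f8mul a a') (f8mul b c'), f8add (f8mul a b') (f8mul b d')),
   (f8add (f8mul c a') (f8mul d c'), f8add (f8mul c b') (f8mul d d'))).
Definition m8one : m8 := ((f8one, f8zero), (f8zero, f8one)).
(** The matrices [[0, 1], [1, 0]] and [[0, w], [w ^ -1, 1]], of orders 2 and 3, whose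
    product has order 7. *)
Definition m8x : m8 := ((f8zero, f8one), (f8one, f8zero)).
Definition m8y : m8 := ((f8zero, (false, true, false)), ((true, false, true), f8one)).
(** Multiplication of pairs made of a code of matrix and of a table. *)
Definition pair_mul (u v : m8 * seq nat) := (m8mul u.1 v.1, tcomp u.2 v.2).

(** * The subgroup PSL(2,8) of the second group *)

(** The list of cycles in the definition of [g]. *)
Ltac cycles_of g :=
  let g' := eval unfold g in g in
  match g' with perm_of_cycles ?cs => exact cs end.

Definition h1_tab : seq nat := cycles_tab ltac:(cycles_of h1).
Definition h2_tab : seq nat := cycles_tab ltac:(cycles_of h2).
Definition h3_tab : seq nat := cycles_tab ltac:(cycles_of h3).

Lemma ptab_h1 : ptab h1 = h1_tab. Proof. exact: ptab_cycles. Qed.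
Lemma ptab_h2 : ptab h2 = h2_tab. Proof. exact: ptab_cycles. Qed.
Lemma ptab_h3 : ptab h3 = h3_tab. Proof. exact: ptab_cycles. Qed.

(** Two elements of [H2], of orders 2 and 3, with product of order 7, that generate its
    subgroup PSL(2,8).  The index is the order. *)
Definition u2 : {perm 'I_36} := foldr mulg 1 [:: h1; h2; h2; h1; h2].
Definition u3 : {perm 'I_36} := h2.
Definition u2_tab : seq nat := foldr tcomp tid [:: h1_tab; h2_tab; h2_tab; h1_tab; h2_tab].

Lemma ptab_u2 : ptab u2 = u2_tab.
Proof. by rewrite (foldr_morph ptabM ptab1) /= ptab_h1 ptab_h2. Qed.

(** The list of words evaluated on the pairs made of a matrix and of a permutation that
    are to correspond to each other; that the list is closed under multiplication, without
    repetition in either component, makes it the graph of an isomorphism. *)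
Definition graph_pairs : seq (m8 * seq nat) :=
  psl_words pair_mul (m8one, tid) (m8x, u2_tab) (m8y, h2_tab).

Lemma graph_pairs_uniq1 : uniq (map fst graph_pairs). Proof. by vm_compute. Qed.
Lemma graph_pairs_uniq2 : uniq (map snd graph_pairs). Proof. by vm_compute. Qed.
Lemma graph_pairs_closed :
  all (fun u => (pair_mul u (m8x, u2_tab) \in graph_pairs)
                && (pair_mul u (m8y, h2_tab) \in graph_pairs)) graph_pairs.
Proof. by vm_compute. Qed.
Lemma size_graph_pairs : size graph_pairs = 504. Proof. by vm_compute. Qed.

Lemma uniq_map_inj (T T' : eqType) (f : T -> T') (s : seq T) :
  uniq (map f s) -> {in s &, injective f}.
Proof.
elim: s => //= u s IHs /andP[fu's /IHs{}IHs] a b; rewrite !inE.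
case/predU1P=> [->|sa] /predU1P[->|sb] // eq_f; last exact: IHs.
  by rewrite eq_f map_f in fu's.
by rewrite -eq_f map_f in fu's.
Qed.

Lemma psl_words_sub (gT : finGroupType) (H : {group gT}) (x y : gT) :
  x \in H -> y \in H -> {subset psl_words mulg 1 x y <= H}.
Proof.
move=> Hx Hy.
have Hprod us vs : {subset us <= H} -> {subset vs <= H} ->
    {subset [seq u * v | u <- us, v <- vs] <= H}.
  by move=> Hus Hvs _ /allpairsP[[u v] /= [/Hus Hu /Hvs Hv ->]]; rewrite groupM.
have Hpow u n : u \in H -> {subset pow_list mulg 1 u n <= H}.
  by move=> Hu _ /mapP[i _ ->]; elim: i => //= i IHi; rewrite groupM.
have Hcs : {subset pow_list mulg 1 (x * y) 7 <= H} by apply: Hpow; rewrite groupM.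
apply: (Hprod); first by apply: Hpow; rewrite /= !groupM.
apply: (Hprod) => // v; rewrite inE => /predU1P[->|/mapP[u /Hcs Hu ->]] //.
by rewrite /= !groupM.
Qed.

(** A list of elements of a generated group that contains 1 and is closed under right
    multiplication by the generators exhausts the group. *)
Lemma gen_list (gT : finGroupType) (A : {set gT}) (L : seq gT) :
    1 \in L -> {subset L <= <<A>>} -> {in L & A, forall u v, u * v \in L} ->
  <<A>> =i L.
Proof.
move=> L1 LA closedL u; apply/idP/idP=> [|/LA//].
case/gen_prodgP=> n [c Ac ->]; elim: n c Ac => [|n IHn] c Ac.
  by rewrite big_ord0.
by rewrite big_ord_recr closedL // IHn.
Qed.

(** The normal subgroup PSL(2,8) of [H2]. *)
Definition K2 : {group {perm 'I_36}} := <<[set u2; u3]>>%G.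

(** The tables of the 504 elements of [K2]. *)
Definition K2_tabs : seq (seq nat) := psl_words tcomp tid u2_tab h2_tab.

Lemma K2_tabsE : K2_tabs = map ptab (psl_words mulg 1 u2 u3).
Proof. by rewrite (map_psl_words ptabM ptab1) ptab_u2 ptab_h2. Qed.

Lemma K2_tabs_graph : K2_tabs = map snd graph_pairs.
Proof. by rewrite (map_psl_words (mul' := tcomp) (one' := tid)). Qed.

Lemma K2_list : K2 =i psl_words mulg 1 u2 u3.
Proof.
apply: gen_list.
- by rewrite -(mem_map ptab_inj) -K2_tabsE ptab1; vm_compute.
- by apply: psl_words_sub; apply: mem_gen; [apply: set21 | apply: set22].
move=> u v; rewrite -!(mem_map ptab_inj) -K2_tabsE K2_tabs_graph ptabM.
case/mapP=> p graph_p -> /set2P[] ->; rewrite ?ptab_u2 ?ptab_h2.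
  by have /andP[/(map_f snd)] := allP graph_pairs_closed p graph_p.
by have /andP[_ /(map_f snd)] := allP graph_pairs_closed p graph_p.
Qed.

Lemma mem_K2 s : (s \in K2) = (ptab s \in K2_tabs).
Proof. by rewrite K2_list K2_tabsE (mem_map ptab_inj). Qed.

Lemma card_K2 : #|K2| = 504.
Proof.
rewrite (eq_card K2_list) (card_uniqP _); last first.
  by rewrite -(map_inj_uniq ptab_inj) -K2_tabsE K2_tabs_graph graph_pairs_uniq2.
by rewrite -(size_map ptab) -K2_tabsE K2_tabs_graph size_map size_graph_pairs.
Qed.

Lemma h3_cube : h3 ^+ 3 = 1.
Proof.
by apply: ptab_inj; rewrite !expgS expg0 !ptabM ptab1 ptab_h3; vm_compute.
Qed.

Lemma h3V : h3^-1 = h3 * h3.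
Proof. by apply/eqP; rewrite eq_invg_mul -h3_cube !expgS expg0 mulg1 ?mulgA. Qed.

Lemma K2_h1 : h1 \in K2.
Proof. by rewrite mem_K2 ptab_h1; vm_compute. Qed.

Lemma K2_h3 : h3 \notin K2.
Proof. by rewrite mem_K2 ptab_h3; vm_compute. Qed.

Lemma order_h3 : #[h3] = 3.
Proof.
apply: nt_prime_order => //; first exact: h3_cube.
by apply: contraNneq K2_h3 => ->; apply: group1.
Qed.

Lemma h3_norm : h3 \in 'N(K2).
Proof.
rewrite inE -genJ gen_subG; apply/subsetP=> _ /imsetP[s /set2P[] -> ->].
  by rewrite mem_K2 /conjg h3V (ptabM (_ * _)) (ptabM h3) (ptabM u2) ptab_h3 ptab_u2;
     vm_compute.
by rewrite mem_K2 /conjg h3V (ptabM (_ * _)) (ptabM h3) (ptabM u3) ptab_h3 ptab_h2; vm_compute.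
Qed.

Lemma H2E : H2 = K2 * <[h3]> :> {set _}.
Proof.
have sK : K2 \subset H2.
  have [H2h1 H2h2] : h1 \in H2 /\ h2 \in H2 by rewrite !mem_gen // !inE eqxx ?orbT.
  by rewrite gen_subG subUset !sub1set /u2 /= !groupM ?group1.
rewrite -norm_joinEr ?cycle_subG ?h3_norm //; apply/eqP.
rewrite eqEsubset gen_subG; apply/andP; split; last first.
  by rewrite join_subG sK cycle_subG mem_gen // !inE eqxx orbT.
apply/subsetP=> s /setUP[/set2P[] ->|/set1P->].
- exact: subsetP (joing_subl _ _) _ K2_h1.
- by rewrite (subsetP (joing_subl _ _)) // mem_gen // set22.
by rewrite (subsetP (joing_subr _ _)) // cycle_id.
Qed.

Lemma K2_H2 : K2 <| H2.
Proof.
rewrite /normal H2E mulG_subl mul_subG ?normG //.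
by rewrite cycle_subG h3_norm.
Qed.

Lemma card_H2 : #|H2| = 1512.
Proof.
rewrite H2E TI_cardMg ?card_K2 -?orderE ?order_h3 // setIC prime_TIg -?orderE ?order_h3 //.
by rewrite cycle_subG K2_h3.
Qed.

(** The tables of the 1512 elements of [H2]: the three cosets of [K2] represented by
    1, [h3] and [h3 ^ 2]. *)
Definition H2_tabs : seq (seq nat) :=
  [seq tcomp u v | u <- K2_tabs, v <- [:: tid; h3_tab; tcomp h3_tab h3_tab]].

Lemma mem_H2 s : s \in H2 -> ptab s \in H2_tabs.
Proof.
rewrite H2E => /mulsgP[k c]; rewrite mem_K2 => Kk /cycleP[i ->] ->.
rewrite ptabM; apply: allpairs_f => //.
rewrite (divn_eq i 3) expgD mulnC expgM h3_cube expg1n mul1g.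
have := ltn_pmod i (isT : 0 < 3); case: (i %% 3) => [|[|[|//]]] _.
- by rewrite ptab1 mem_head.
- by rewrite expg1 ptab_h3 in_cons mem_head orbT.
by rewrite expgS expg1 ptabM ptab_h3 2!in_cons mem_head !orbT.
Qed.

Lemma H2_tabs_sub t : t \in H2_tabs -> exists2 s, s \in H2 & ptab s = t.
Proof.
case/allpairsP=> [[u v] /= []].
rewrite K2_tabsE => /mapP[k]; rewrite -K2_list => Kk -> v_in ->.
have H2k : k \in H2 by apply: (subsetP (normal_sub K2_H2)).
have H2h3 : h3 \in H2 by rewrite mem_gen // !inE eqxx orbT.
move: v_in; rewrite !inE => /or3P[] /eqP->.
- by exists k => //; rewrite -ptab1 -ptabM mulg1.
- by exists (k * h3); rewrite ?groupM // ptabM ptab_h3.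
by exists (k * (h3 * h3)); rewrite ?groupM // !ptabM ptab_h3.
Qed.

Lemma cent_K2 : 'C_H2(K2) = 1.
Proof.
apply/trivgP/subsetP=> s /setIP[/mem_H2 H2s /centP cKs].
have check : all (fun t => [&& tcomp t u2_tab == tcomp u2_tab t
                             & tcomp t h2_tab == tcomp h2_tab t] ==> (t == tid)) H2_tabs.
  by vm_compute.
have E2 : tcomp (ptab s) u2_tab = tcomp u2_tab (ptab s).
  rewrite -ptab_u2 -(ptabM s) -(ptabM u2).
  congr ptab; apply: cKs; apply: mem_gen; exact: set21.
have E3 : tcomp (ptab s) h2_tab = tcomp h2_tab (ptab s).
  rewrite -ptab_h2 -(ptabM s) -(ptabM h2).
  congr ptab; apply: cKs; apply: mem_gen; exact: (set22 u2 u3).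
have := allP check _ H2s; rewrite E2 E3 !eqxx => /eqP; rewrite -ptab1.
by move/ptab_inj->; apply: set11.
Qed.

Lemma K2_trans : [transitive K2, on [set: 'I_36] | 'P].
Proof.
apply/imsetP; exists ord0; rewrite ?inE //; apply/esym/eqP; rewrite -subTset.
apply/subsetP=> i _.
have check : all (fun j => j \in map (nth 0 ^~ 0%N) K2_tabs) tid by vm_compute.
have /(allP check)/mapP[t] : val i \in tid by rewrite mem_iota /=.
rewrite K2_tabsE => /mapP[s]; rewrite -K2_list => Ks -> iE.
apply/orbitP; exists s; [exact: Ks | apply: val_inj; rewrite iE].
by rewrite (nth_ptab s ord0).
Qed.

(** An element of order 7 with a single fixed point. *)
Definition u7 : {perm 'I_36} := u2 * u3.

Lemma ptab_u7 : ptab u7 = tcomp u2_tab h2_tab.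
Proof. by rewrite -ptab_u2 -ptab_h2 -(ptabM u2). Qed.

Lemma u7_order : #[u7] = 7.
Proof.
apply: nt_prime_order => //.
  apply: ptab_inj; rewrite !expgS expg0 !(ptabM u7) ptab1 ptab_u7.
  by vm_compute.
by rewrite -(inj_eq ptab_inj) ptab1 ptab_u7; vm_compute.
Qed.

Lemma u7_fix : exists i0, forall i, (u7 i == i) = (i == i0).
Proof.
have check : all (fun i => (nth 0 (tcomp u2_tab h2_tab) i == i) == (i == 10)) tid.
  by vm_compute.
(* The fixed point has number 10, counting from 0. *)
exists (inord 10) => i; rewrite -!val_eqE /= inordK // -nth_ptab ptab_u7.
have /(allP check)/eqP <- : val i \in tid by rewrite mem_iota /=.
by [].
Qed.

Local Close Scope group_scope.

(** * The field with 8 elements *)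

(** All the codes of field elements. *)
Definition f8_enum : seq f8 :=
  [seq (ab, c) | ab <- [seq (a, b) | a <- [:: false; true], b <- [:: false; true]],
               c <- [:: false; true]].
Lemma mem_f8_enum a : a \in f8_enum.
Proof. by case: a => [[[] []] []]. Qed.

Lemma f8_inv (a : f8) : a != f8zero -> exists b, f8mul a b = f8one.
Proof.
move=> a0; have : has (fun b => f8mul a b == f8one) f8_enum by case: a a0 => [[[] []] []].
by case/hasP=> b _ /eqP; exists b.
Qed.

Section Field8.

Import GRing.Theory.
Local Open Scope ring_scope.

Variable F : finFieldType.
Hypothesis cardF : #|F| = 8%N.

Lemma char2 : 2%:R = 0 :> F.
Proof.
have /andP[_ /eqP] : (2 \in [pchar F])%N by apply: (@card_finPcharP F 2 3).
by [].
Qed.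

Lemma addrr2 (x : F) : x + x = 0.
Proof. by rewrite -mulr2n -mulr_natl char2 mul0r. Qed.

(** An element [x] other than 0 and 1 is a root of [X ^ 8 - X], hence, in
    characteristic 2, of [X ^ 3 + X + 1] or of [X ^ 3 + X ^ 2 + 1]; in the latter case
    [x^-1] is a root of the former. *)
Lemma F8_generator : exists w : F, w ^+ 3 = w + 1.
Proof.
have [x /andP[x0 x1]] : exists x : F, (x != 0) && (x != 1).
  have : (0 < #|[set: F] :\ 0%R :\ 1%R|)%N.
    have := cardF; rewrite -cardsT (cardsD1 0) (cardsD1 1) !inE oner_neq0 /=.
    by case: #|_|.
  by case/card_gt0P=> x; rewrite !inE andbT andbC; exists x.
have x8 : x ^+ 8 = x by rewrite -cardF expf_card.
have : (x * (x - 1)) * ((x ^+ 3 + x + 1) * (x ^+ 3 + x ^+ 2 + 1)) = 0.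
  transitivity (x ^+ 8 - x + 2%:R * (x ^+ 5 - x ^+ 4)); first by ring.
  by rewrite x8 char2 subrr mul0r addr0.
move/eqP; rewrite !mulf_eq0 subr_eq0 (negPf x0) (negPf x1) /=.
case/orP=> /eqP root_x.
  exists x; apply/eqP; rewrite -subr_eq0 -root_x -subr_eq0; apply/eqP.
  transitivity (- (2%:R * (x + 1))); first by ring.
  by rewrite char2 mul0r oppr0.
exists x^-1; apply: (mulfI (expf_neq0 3 x0)).
rewrite -exprMn mulfV // expr1n; apply/eqP; rewrite -subr_eq0; apply/eqP.
transitivity (2%:R - (x ^+ 3 + x ^+ 2 + 1)); first by field.
by rewrite char2 root_x subrr.
Qed.

Variable w : F.
Hypothesis w3 : w ^+ 3 = w + 1.

(** The field element coded by [a]. *)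
Definition f8val (a : f8) : F :=
  let: (a0, a1, a2) := a in a0%:R + a1%:R * w + a2%:R * w ^+ 2.

Lemma f8valD a b : f8val (f8add a b) = f8val a + f8val b.
Proof.
have natD (b1 b2 : bool) : (b1 (+) b2)%:R = b1%:R + b2%:R :> F.
  by case: b1 b2 => [] []; rewrite /= ?add0r ?addr0 ?addrr2.
by case: a b => [[a0 a1] a2] [[b0 b1] b2]; rewrite /= !natD; ring.
Qed.

Lemma f8valM a b : f8val (f8mul a b) = f8val a * f8val b.
Proof.
have natD (b1 b2 : bool) : (b1 (+) b2)%:R = b1%:R + b2%:R :> F.
  by case: b1 b2 => [] []; rewrite /= ?add0r ?addr0 ?addrr2.
have natM (b1 b2 : bool) : (b1 && b2)%:R = b1%:R * b2%:R :> F.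
  by rewrite -natrM mulnb.
case: a b => [[a0 a1] a2] [[b0 b1] b2]; rewrite /= !natD !natM.
move: (a0%:R) (a1%:R) (a2%:R) (b0%:R) (b1%:R) (b2%:R) => {}a0 {}a1 {}a2 {}b0 {}b1 {}b2.
pose u := a1 * b2 + a2 * b1 + a2 * b2 * w.
apply/eqP; rewrite -subr_eq0; apply/eqP.
transitivity (u * (w + 1 - w ^+ 3)); first by rewrite /u; ring.
by rewrite w3 subrr mulr0.
Qed.

Lemma f8val0 : f8val f8zero = 0. Proof. by rewrite /= !mul0r !addr0. Qed.
Lemma f8val1 : f8val f8one = 1. Proof. by rewrite /= !mul0r !addr0. Qed.

Lemma f8val_inj : injective f8val.
Proof.
move=> a b eq_ab; have ab0 : f8val (f8add a b) = 0 by rewrite f8valD eq_ab addrr2.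
have [|/f8_inv[c /(congr1 f8val)]] := eqVneq (f8add a b) f8zero.
  by case: a b {eq_ab ab0} => [[[] []] []] [[[] []] []].
by rewrite f8valM ab0 f8val1 mul0r => /esym/eqP; rewrite oner_eq0.
Qed.

Lemma f8val_bij : bijective f8val.
Proof. by apply: inj_card_bij f8val_inj _; rewrite cardF !card_prod card_bool. Qed.

End Field8.

(** * The isomorphism with SL(2,8) *)

Local Open Scope group_scope.

(** A subgroup of a direct product on which both projections are injective is the graph
    of an isomorphism between its projections. *)
Lemma graph_isog (gT1 gT2 : finGroupType) (x1 y1 : gT1) (x2 y2 : gT2)
    (L : seq (gT1 * gT2)) :
    <<[set (x1, x2); (y1, y2)]>> =i L -> uniq (map fst L) -> uniq (map snd L) ->
  <<[set x1; y1]>> \isog <<[set x2; y2]>>.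
Proof.
set A := [set _; _] => LE U1 U2.
have inj (gT : finGroupType) (f : {morphism [set: gT1 * gT2] >-> gT}) :
    {in L &, injective f} -> <<A>> \isog << [set f (x1, x2); f (y1, y2)] >>.
  move=> injf; have sA := subsetT <<A>>.
  apply/isogP; exists (restrm sA f).
    by apply/injmP=> u v /=; rewrite !LE; apply: injf.
  rewrite morphim_restrm setIid morphim_gen ?subsetT //; congr <<_>>.
  by rewrite morphimEsub ?subsetT // imsetU !imset_set1.
have iso1 := inj _ (fst_morphism gT1 gT2) (uniq_map_inj U1).
have iso2 := inj _ (snd_morphism gT1 gT2) (uniq_map_inj U2).
by apply: isog_trans iso2; rewrite isog_sym.
Qed.

Local Close Scope group_scope.

Section CodeSL2.

Import GRing.Theory.
Local Open Scope ring_scope.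

Variable F : finFieldType.
Hypothesis cardF : #|F| = 8%N.

(** The inverse of [f8val] is a coding of the field. *)
Lemma f8_code : exists c : F -> f8,
  [/\ bijective c, c 0 = f8zero, c 1 = f8one,
      {morph c : x y / x + y >-> f8add x y} & {morph c : x y / x * y >-> f8mul x y}].
Proof.
have [w w3] := F8_generator cardF.
have [c cK Kc] := f8val_bij cardF w3.
exists c; split=> [||| x y | x y]; first by exists (f8val w).
- by rewrite -(f8val0 w) cK.
- by rewrite -(f8val1 w) cK.
- by apply: (can_inj cK); rewrite f8valD // !Kc.
by apply: (can_inj cK); rewrite f8valM // !Kc.
Qed.

Variable c : F -> f8.
Hypotheses (bij_c : bijective c) (c0 : c 0 = f8zero) (c1 : c 1 = f8one).
Hypotheses (cD : {morph c : x y / x + y >-> f8add x y}).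
Hypotheses (cM : {morph c : x y / x * y >-> f8mul x y}).

Let i0 : 'I_2 := ord0.
Let i1 : 'I_2 := lift ord0 ord0.

(** The code of a matrix; [i0] and [i1] are the two indices. *)
Definition mx_code (A : 'M[F]_2) : m8 :=
  ((c (A i0 i0), c (A i0 i1)), (c (A i1 i0), c (A i1 i1))).

(** The determinant; signs do not matter in characteristic 2. *)
Definition det8 (M : m8) : f8 :=
  let: ((a, b), (a', b')) := M in f8add (f8mul a b') (f8mul b a').

Lemma ord2E (i : 'I_2) : i = i0 \/ i = i1.
Proof. by case: i => [[|[|//]] ?]; [left | right]; apply: val_inj. Qed.

Lemma mx_code_inj : injective mx_code.
Proof.
have inj_c := bij_inj bij_c.
move=> A A' [/inj_c E00 /inj_c E01 /inj_c E10 /inj_c E11].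
by apply/matrixP=> i j; case: (ord2E i) (ord2E j) => -> [] ->.
Qed.

Lemma mx_codeM A A' : mx_code (A *m A') = m8mul (mx_code A) (mx_code A').
Proof.
have sum2 (f : 'I_2 -> F) : \sum_i f i = f i0 + f i1.
  by rewrite !big_ord_recl big_ord0 addr0.
by rewrite /mx_code !mxE !sum2 !cD !cM.
Qed.

Lemma mx_code1 : mx_code 1%:M = m8one.
Proof. by rewrite /mx_code !mxE /= c0 c1. Qed.

Lemma mx_code_surj M : exists A, mx_code A = M.
Proof.
case: bij_c => d _ dK; case: M => [[m00 m01] [m10 m11]].
exists (\matrix_(i, j) d (if i == i0 then if j == i0 then m00 else m01
                          else if j == i0 then m10 else m11)).
by rewrite /mx_code !mxE /= !dK.
Qed.

Lemma det_code A : c (\det A) = det8 (mx_code A).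
Proof.
have lift1 : lift i1 (0 : 'I_1) = i0 by apply: val_inj.
have opp2 (x : F) : - x = x by apply/eqP; rewrite -subr_eq0 -opprD oppr_eq0 addrr2.
rewrite (expand_det_row A i0) !big_ord_recl big_ord0 addr0 /cofactor !det_mx11 !mxE.
by rewrite /= addn0 expr0 mul1r expr1 mulN1r opp2 lift1 cD !cM.
Qed.

Lemma SL2_code M : det8 M = f8one ->
  exists2 g : {'GL_2[F]}, g \in SL2 F & mx_code (GLval g) = M.
Proof.
have [A <-] := mx_code_surj M; rewrite -det_code -c1 => /(bij_inj bij_c) detA.
have uA : A \is a GRing.unit by rewrite -[_ \is a _]/(A \in unitmx) unitmxE detA unitr1.
by exists (FinRing.Unit uA); rewrite // inE /= detA.
Qed.

(** Direct count of the codes of determinant 1. *)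
Lemma card_SL2_le : (#|SL2 F| <= 504)%N.
Proof.
pose rows := [seq (a, b) | a <- f8_enum, b <- f8_enum].
pose codes := [seq M <- [seq (r, r') | r <- rows, r' <- rows] | det8 M == f8one].
have mem_rows r : r \in rows by case: r => a b; apply: allpairs_f; apply: mem_f8_enum.
have codes_size : size codes = 504%N by vm_compute.
rewrite -codes_size cardE -(size_map (fun g : {'GL_2[F]} => mx_code (GLval g))).
apply: uniq_leq_size.
  rewrite map_inj_uniq ?enum_uniq // => g h /mx_code_inj.
  by move=> eq_gh; apply: val_inj.
move=> M /mapP[g]; rewrite mem_enum inE => /eqP detg ->{M}.
rewrite mem_filter -det_code detg c1 eqxx andTb.
case: (mx_code _) => r r'. exact: (allpairs_f pair (mem_rows r) (mem_rows r')).
Qed.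

(** The matrices with codes [m8x] and [m8y] generate SL(2,8), and the list of words
    shows that the subgroup generated by [(gx, a)] and [(gy, b)] is a graph. *)
Lemma SL2_isog_tables (a b : {perm 'I_36}) (ta tb : seq nat)
    (prs := psl_words pair_mul (m8one, tid) (m8x, ta) (m8y, tb)) :
    ptab a = ta -> ptab b = tb -> (m8one, tid) \in prs ->
    uniq (map fst prs) -> uniq (map snd prs) ->
    all (fun u => (pair_mul u (m8x, ta) \in prs) && (pair_mul u (m8y, tb) \in prs)) prs ->
    #|<<[set a; b]>>%g| = 504%N ->
  <<[set a; b]>>%g \isog SL2 F.
Proof.
move=> Ea Eb prs1 uniq1 uniq2 closed oK.
have [gx SLx gxE] : exists2 g : {'GL_2[F]}, g \in SL2 F & mx_code (GLval g) = m8x.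
  exact: SL2_code.
have [gy SLy gyE] : exists2 g : {'GL_2[F]}, g \in SL2 F & mx_code (GLval g) = m8y.
  exact: SL2_code.
pose gT : finGroupType := ({'GL_2[F]} * {perm 'I_36})%type.
pose code (u : gT) : m8 * seq nat :=
  (mx_code (GLval u.1), ptab u.2).
have codeM (u v : gT) : code (u * v)%g = pair_mul (code u) (code v).
  by rewrite /code /pair_mul /= mx_codeM ptabM.
have code1 : code 1%g = (m8one, tid) by rewrite /code /= mx_code1 ptab1.
have code_inj : injective code.
  move=> [g s] [g' s'] eq_code; congr (_, _).
    by apply: val_inj; apply: mx_code_inj; apply: (congr1 fst eq_code).
  by apply: ptab_inj; apply: (congr1 snd eq_code).
have codex : code (gx, a) = (m8x, ta) by rewrite /code gxE Ea.
have codey : code (gy, b) = (m8y, tb) by rewrite /code gyE Eb.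
pose L : seq gT := psl_words (@mulg gT) 1%g (gx, a) (gy, b).
have LE : map code L = prs.
  by rewrite (map_psl_words codeM code1) codex codey.
pose A : {set gT} := [set (gx, a); (gy, b)].
have genL : <<A>>%g =i L.
  apply: gen_list.
  - by rewrite -(mem_map code_inj) LE code1.
  - exact: (@psl_words_sub _ <<A>>%G _ _ (mem_gen (set21 _ _)) (mem_gen (set22 _ _))).
  move=> u v; rewrite -!(mem_map code_inj) LE codeM.
  move=> /(allP closed)/andP[ux uy] /set2P[] ->.
    by rewrite codex.
  by rewrite codey.
have U1 : uniq (map fst L).
  rewrite -(map_inj_uniq (f := fun g : {'GL_2[F]} => mx_code (GLval g))) -?map_comp.
    by rewrite (map_comp fst code) LE uniq1.
  by move=> g h /mx_code_inj eq_gh; apply: val_inj.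
have U2 : uniq (map snd L).
  by rewrite -(map_inj_uniq ptab_inj) -map_comp (map_comp snd code) LE uniq2.
have isoK := graph_isog genL U1 U2.
have <- : <<[set gx; gy]>>%g = SL2 F :> {set _}.
  apply/eqP; rewrite eqEcard gen_subG subUset !sub1set SLx SLy /=.
  by rewrite (card_isog isoK) oK card_SL2_le.
by rewrite isog_sym.
Qed.

End CodeSL2.

Lemma K2_isog_SL2 (F : finFieldType) : #|F| = 8 -> K2 \isog SL2 F.
Proof.
move=> cardF; have [c [bij_c c0 c1 cD cM]] := f8_code cardF.
apply: (SL2_isog_tables cardF bij_c c0 c1 cD cM ptab_u2 ptab_h2).
- by vm_compute.
- exact: graph_pairs_uniq1.
- exact: graph_pairs_uniq2.
- exact: graph_pairs_closed.
exact: card_K2.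
Qed.

(** * Automorphisms of PSL(2,8) *)

Local Open Scope group_scope.

Lemma Aut_eq_gen (gT : finGroupType) (A : {set gT}) (a b : {perm gT}) :
  a \in Aut <<A>> -> b \in Aut <<A>> -> {in A, a =1 b} -> a = b.
Proof.
move=> Aa Ab eq_ab; apply: (eq_Aut Aa Ab) => _ /gen_prodgP[n [c Ac ->]].
elim: n c Ac => [|n IHn] c Ac.
  by rewrite big_ord0 -(autmE Aa) -(autmE Ab) !morph1.
have Gc i : c i \in <<A>> by apply: mem_gen.
rewrite big_ord_recr /=; have Gp : \prod_(i < n) c (widen_ord (leqnSn n) i) \in <<A>>.
  by apply: group_prod => i _; apply: Gc.
rewrite (morphicP (Aut_morphic Aa)) // (morphicP (Aut_morphic Ab)) //.
have /= -> := IHn (fun i => c (widen_ord (leqnSn n) i)) (fun i => Ac _).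
by rewrite eq_ab.
Qed.

(** The pairs of elements of [K2] of orders 2 and 3 whose product has order 7.  The first
    element being an involution, the equations on the second one and on the product
    imply that these are not 1. *)
Definition Hurwitz_tabs : seq (seq nat * seq nat) :=
  let T2 := [seq t <- K2_tabs | (t != tid) && (tcomp t t == tid)] in
  let T3 := [seq t <- K2_tabs | tcomp t (tcomp t t) == tid] in
  [seq tu <- [seq (t, u) | t <- T2, u <- T3]
         | iter 7 (tcomp (tcomp tu.1 tu.2)) tid == tid].

Lemma size_Hurwitz_tabs : size Hurwitz_tabs = 1512.
Proof. by vm_compute. Qed.

Lemma u2_involution : u2 * u2 = 1.
Proof. by apply: ptab_inj; rewrite (ptabM u2) ptab1 ptab_u2; vm_compute. Qed.

Lemma u2_neq1 : u2 != 1.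
Proof. by rewrite -(inj_eq ptab_inj) ptab1 ptab_u2; vm_compute. Qed.

Lemma u3_cube : u3 * (u3 * u3) = 1.
Proof. by apply: ptab_inj; rewrite !(ptabM u3) ptab1 ptab_h2; vm_compute. Qed.

(** An automorphism of [K2] is determined by the images of [u2] and [u3], which form one
    of the 1512 pairs above. *)
Lemma card_Aut_K2 : #|Aut K2| <= 1512.
Proof.
pose f (a : {perm {perm 'I_36}}) := (ptab (a u2), ptab (a u3)).
rewrite -size_Hurwitz_tabs cardE -(size_map f).
have K2u2 : u2 \in K2 by apply: mem_gen; apply: set21.
have K2u3 : u3 \in K2 by apply: mem_gen; apply: set22.
apply: uniq_leq_size.
  rewrite map_inj_in_uniq ?enum_uniq // => a b; rewrite !mem_enum => Aa Ab eq_f.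
  apply: (Aut_eq_gen Aa Ab) => s /set2P[] ->; apply: ptab_inj.
    exact: (congr1 fst eq_f).
  exact: (congr1 snd eq_f).
move=> tu /mapP[a]; rewrite mem_enum => Aa ->.
have aM : {in K2 &, {morph a : x y / x * y}} := morphicP (Aut_morphic Aa).
have a1 : a 1 = 1 by rewrite -(autmE Aa) morph1.
have Ka s : s \in K2 -> ptab (a s) \in K2_tabs.
  by move=> Ks; rewrite -mem_K2 (Aut_closed Aa).
have E2 : tcomp (ptab (a u2)) (ptab (a u2)) = tid.
  by rewrite -(ptabM (a u2)) -aM // u2_involution a1 ptab1.
have E3 : tcomp (ptab (a u3)) (tcomp (ptab (a u3)) (ptab (a u3))) = tid.
  rewrite -(ptabM (a u3) (a u3)) -(ptabM (a u3)) -(aM u3 u3) // -(aM u3) ?groupM //.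
  by rewrite u3_cube a1 ptab1.
have E7 : iter 7 (tcomp (tcomp (ptab (a u2)) (ptab (a u3)))) tid = tid.
  rewrite -(ptabM (a u2)) -(aM u2) //; set s := a (u2 * u3).
  have -> : iter 7 (tcomp (ptab s)) tid = ptab (s ^+ 7).
    by rewrite -ptab1 /= -!(ptabM s) !expgS expg0.
  have K7 : u7 \in K2 by apply: groupM.
  have a7 : a (u7 ^+ 7) = s ^+ 7 by rewrite -!(autmE Aa) morphX.
  by have := expg_order u7; rewrite u7_order => u7_7; rewrite -a7 u7_7 a1 ptab1.
have N2 : ptab (a u2) != tid.
  apply: contraNneq u2_neq1; rewrite -ptab1 => /ptab_inj ak2.
  by apply/eqP; apply: (@perm_inj _ a); rewrite ak2 a1.
rewrite /Hurwitz_tabs mem_filter; apply/andP; split; first exact/eqP/E7.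
apply: allpairs_f; rewrite mem_filter Ka // andbT; last exact/eqP/E3.
by apply/andP; split; [apply: N2 | apply/eqP/E2].
Qed.

(** Conjugation embeds [H2], of order 1512, in [Aut K2]. *)
Lemma H2_isog_Aut : H2 \isog Aut K2.
Proof.
have nKH := normal_norm K2_H2.
apply/isogP; exists (restrm nKH (conj_aut K2)).
  by rewrite ker_restrm ker_conj_aut cent_K2.
rewrite morphim_restrm setIid; apply/eqP; rewrite eqEcard Aut_conj_aut /=.
apply: leq_trans card_Aut_K2 _; rewrite -card_H2.
have injf : 'injm (restrm nKH (conj_aut K2)).
  by rewrite ker_restrm ker_conj_aut cent_K2.
by rewrite -{1}(card_injm injf) // morphim_restrm setIid.
Qed.

Lemma center_K2 : 'Z(K2) = 1.
Proof.
by apply/trivgP; rewrite -cent_K2 setSI // (normal_sub K2_H2).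
Qed.

Lemma center_isog_K2 (gT : finGroupType) (G : {group gT}) : K2 \isog G -> 'Z(G) = 1.
Proof.
move/isog_center/card_isog => /= oZ; apply/eqP; rewrite trivg_card1 -oZ.
by rewrite center_K2 cards1.
Qed.

Section AbstractPSL.

Variable F : finFieldType.
Hypothesis cardF : #|F| = 8.

Lemma K2_isog_PSL2 : K2 \isog PSL2 F.
Proof.
have isoS := K2_isog_SL2 cardF; apply: isog_trans (isoS) _.
apply: quotient_isog; first by rewrite normal_norm // center_normal.
have Z1 : 'Z(SL2 F) = 1 := center_isog_K2 isoS.
by apply/trivgP; rewrite /= Z1 subsetIl.
Qed.

Lemma K2_isog_Inn : K2 \isog PSL2_in_PGammaL2 F.
Proof.
have isoP := K2_isog_PSL2; apply: isog_trans (isoP) _.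
apply/isogP; exists (restrm (normG (PSL2 F)) (conj_aut (PSL2 F))).
  by rewrite ker_restrm ker_conj_aut -[_ :&: _]/'Z(PSL2 F) (center_isog_K2 isoP).
by rewrite morphim_restrm setIid.
Qed.

Lemma H2_isog_PGammaL2 : H2 \isog PGammaL2 F.
Proof.
apply: isog_trans H2_isog_Aut _; rewrite isog_sym.
have /isogP[f injf fE] := K2_isog_PSL2.
by have := injm_Aut injf (subxx K2); rewrite fE.
Qed.

(** The index of PSL(2,8) in its automorphism group is the prime 3. *)
Lemma PSL2_PGammaL2_cases (J : {group {perm coset_of 'Z(SL2 F)}}) :
    PSL2_in_PGammaL2 F \subset J -> J \subset PGammaL2 F ->
  J = PSL2_in_PGammaL2 F :> {set _} \/ J = PGammaL2 F :> {set _}.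
Proof.
move=> sPJ sJA.
have oP : #|PSL2_in_PGammaL2 F| = 504 by rewrite -(card_isog K2_isog_Inn) card_K2.
have oA : #|PGammaL2 F| = 1512 by rewrite -(card_isog H2_isog_PGammaL2) card_H2.
have oPJ := Lagrange sPJ; have := Lagrange sJA; rewrite oA -oPJ oP => oJA.
have [j1|j1] := eqVneq #|J : PSL2_in_PGammaL2 F| 1%N.
  by left; apply/eqP; rewrite eq_sym eqEcard sPJ -oPJ oP j1.
right; apply/eqP; rewrite eqEcard sJA oA -oPJ oP; nia.
Qed.

End AbstractPSL.

Local Close Scope group_scope.

(** * Exhaustive search with weights *)

(** The tails of the bit sequences of [C] that start with [true], and of those that start
    with [false]. *)
Fixpoint split_head (C : seq bitseq) : seq bitseq * seq bitseq :=
  match C with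
  | (b :: m) :: C' =>
    let: (Ct, Cf) := split_head C' in if b then (m :: Ct, Cf) else (Ct, m :: Cf)
  | _ => ([::], [::])
  end.

(** The total weight of the pairs made of the point [p] and of a point whose row of
    weights is in [ch]. *)
Definition row_sum (ch : seq (seq nat)) (p : nat) : nat :=
  foldr (fun r a => nth 0 r p + a) 0 ch.

(** Exhaustive search.  With [n] points left, the first of them being [p], and with the
    rows of weights of the points chosen so far in [ch], their total weight being [acc], the
    search tries all the ways of choosing [k] more points, including the first [f] of
    those left, and checks that whenever the final total weight is [tgt] the choice is
    one of the bit sequences in [C]. *)
Fixpoint exhaust (W : seq (seq nat)) (tgt n f k p acc : nat) (ch : seq (seq nat))
    (C : seq bitseq) : bool :=
  match k, n with
  | 0, _ => (acc == tgt) ==> has (all negb) C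
  | _, 0 => true
  | k'.+1, n'.+1 =>
    let: (Ct, Cf) := split_head C in
    exhaust W tgt n' f.-1 k' p.+1 (acc + row_sum ch p) (nth [::] W p :: ch) Ct &&
    ((0 < f) || exhaust W tgt n' 0 k p.+1 acc ch Cf)
  end.

Section Cover.

Variables (W : seq (seq nat)) (tgt : nat).

(** The total weight of the pairs that involve a point of [xs], the other one being an
    earlier point of [xs] or a point whose row is in [ch]. *)
Fixpoint chain_weight (ch : seq (seq nat)) (xs : seq nat) : nat :=
  if xs is x :: xs' then row_sum ch x + chain_weight (nth [::] W x :: ch) xs' else 0.

Lemma split_headP (C : seq bitseq) m :
  (m \in (split_head C).1 -> true :: m \in C) /\ (m \in (split_head C).2 -> false :: m \in C).
Proof.
elim: C => [|[|b s] C [IHt IHf]] /=; [by split | by split |].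
case: (split_head C) IHt IHf => Ct Cf /= IHt IHf.
case: b => /=; rewrite !inE; split.
- by case/predU1P=> [->|/IHt->]; rewrite ?eqxx ?orbT.
- by move/IHf=> ->; rewrite orbT.
- by move/IHt=> ->; rewrite orbT.
by case/predU1P=> [->|/IHf->]; rewrite ?eqxx ?orbT.
Qed.

Lemma all_negb_nseq (m : bitseq) : all negb m -> m = nseq (size m) false.
Proof. by elim: m => [|[] m IHm] //= /IHm <-. Qed.

Lemma count_id0 (m : bitseq) : (count id m == 0) = all negb m.
Proof. by elim: m => [|[] m IHm]. Qed.

Lemma exhaust_sound n f k p acc ch C m :
    exhaust W tgt n f k p acc ch C -> size m = n -> all id (take f m) ->
    count id m = k -> acc + chain_weight ch (mask m (iota p n)) = tgt ->
    {in C, forall s : bitseq, size s = n} ->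
  m \in C.
Proof.
(* The case [k = 0], where no more point is chosen. *)
have leaf q a c D (s : bitseq) : (a == tgt) ==> has (all negb) D -> count id s = 0 ->
    a + chain_weight c (mask s (iota q (size s))) = tgt ->
    {in D, forall s' : bitseq, size s' = size s} -> s \in D.
  move=> /implyP Dnil /eqP; rewrite count_id0 => s0.
  have := all_negb_nseq s0; set l := size s => ->.
  rewrite mask_false addn0 => /eqP/Dnil/hasP[s' Ds' /all_negb_nseq s'E] szD.
  by rewrite -(szD _ Ds') -s'E.
elim: n f k p acc ch C m => [|n IHn] f [|k] p acc ch C m.
- by move=> /= Hc szm _ ct Ht szC; apply: (leaf p acc ch); rewrite ?szm.
- by move=> _ /size0nil->.
- by move=> /= Hc szm _ ct Ht szC; apply: (leaf p acc ch); rewrite ?szm.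
case: m => [|b m] //= Hc [szm] fm ct Ht szC.
have inT s : s \in (split_head C).1 -> true :: s \in C by have [] := split_headP C s.
have inF s : s \in (split_head C).2 -> false :: s \in C by have [] := split_headP C s.
case: (split_head C) Hc inT inF => Ct Cf /andP[HcT HcF] /= inT inF.
have szT : {in Ct, forall s : bitseq, size s = n} by move=> s /inT/szC [].
have szF : {in Cf, forall s : bitseq, size s = n} by move=> s /inF/szC [].
case: b fm ct Ht => /= fm ct Ht.
  apply: inT; apply: IHn HcT szm _ _ _ szT.
  - by case: (f) fm => //= _; rewrite take0.
  - by case: ct.
  - by rewrite -addnA.
case: f fm HcF HcT => [_ HcF _|//].
by apply: inF; apply: IHn HcF szm _ ct Ht szF; rewrite take0.
Qed.

Lemma row_sum_cons r ch p : row_sum (r :: ch) p = nth 0 r p + row_sum ch p.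
Proof. by []. Qed.

Lemma chain_weightE ch xs :
  chain_weight ch xs = \sum_(x <- xs) row_sum ch x + chain_weight [::] xs.
Proof.
elim: xs ch => [|x xs IHxs] ch /=; first by rewrite big_nil.
rewrite big_cons (IHxs (_ :: ch)) [in RHS]IHxs add0n.
under eq_bigr do rewrite row_sum_cons.
rewrite big_split /= -!addnA; congr (_ + _); rewrite addnCA; congr (_ + (_ + _)).
by apply: eq_bigr => y _; rewrite /= addn0.
Qed.

Lemma chain_weight_sum xs :
    {in xs &, forall x y, nth 0 (nth [::] W x) y = nth 0 (nth [::] W y) x} ->
    uniq xs ->
  \sum_(x <- xs) \sum_(y <- xs | y != x) nth 0 (nth [::] W x) y
    = (chain_weight [::] xs).*2.
Proof.
elim: xs => [|x xs IHxs] symW /=; first by rewrite big_nil.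
case/andP=> xs'x Uxs; rewrite big_cons big_cons eqxx /= add0n chain_weightE.
have {}IHxs := IHxs (sub_in2 (mem_behead (s := x :: xs)) symW) Uxs.
have -> : \sum_(y <- xs | y != x) nth 0 (nth [::] W x) y
    = \sum_(y <- xs) nth 0 (nth [::] W x) y.
  rewrite big_mkcond big_seq [RHS]big_seq; apply: eq_bigr => y xs_y.
  by case: eqP xs'x => // <-; rewrite xs_y.
have -> : \sum_(z <- xs) \sum_(y <- x :: xs | y != z) nth 0 (nth [::] W z) y
    = \sum_(y <- xs) nth 0 (nth [::] W x) y + (chain_weight [::] xs).*2.
  rewrite -IHxs -big_split /= big_seq [RHS]big_seq; apply: eq_bigr => z xs_z.
  rewrite big_cons; case: eqP xs'x => [->|_ _]; first by rewrite xs_z.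
  by rewrite symW ?mem_head // inE xs_z orbT.
have -> : \sum_(y <- xs) row_sum [:: nth [::] W x] y
    = \sum_(y <- xs) nth 0 (nth [::] W x) y.
  by apply: eq_bigr => y _; rewrite /= addn0.
by rewrite doubleD -!addnn !addnA.
Qed.

End Cover.

(** * Sets of points and their images *)

(** The set of points whose numbers are in [xs]. *)
Definition point_set (xs : seq nat) : {set 'I_36} := [set i | val i \in xs].
(** The characteristic sequence of a set of points. *)
Definition set_bits (X : {set 'I_36}) : bitseq := [seq i \in X | i <- enum 'I_36].

Lemma size_set_bits X : size (set_bits X) = 36.
Proof. by rewrite size_map size_enum_ord. Qed.

Lemma nth_set_bits X (i : 'I_36) : nth false (set_bits X) i = (i \in X).
Proof. by rewrite (nth_map i) ?size_enum_ord // nth_ord_enum. Qed.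

Lemma set_bits_inj : injective set_bits.
Proof. by move=> X Y eq_XY; apply/setP=> i; rewrite -!nth_set_bits eq_XY. Qed.

(** The characteristic sequence of [point_set xs], from the list [xs]. *)
Definition bits (xs : seq nat) : bitseq :=
  foldr (fun x m => set_nth false m x true) (nseq 36 false) xs.

Lemma nth_bits xs i : nth false (bits xs) i = (i \in xs).
Proof.
elim: xs => [|x xs IHxs]; first by have := nth_nseq false 36 false i; rewrite if_same.
rewrite [bits _]/(set_nth false (bits xs) x true) nth_set_nth inE -IHxs.
by rewrite [LHS]/=; case: eqP.
Qed.

Lemma bits_point_set xs : all (gtn 36) xs -> bits xs = set_bits (point_set xs).
Proof.
move=> xs36; have szb : size (bits xs) = 36.
  elim: xs xs36 => [|x xs IHxs] // /andP[x36 /IHxs szb].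
  rewrite [bits _]/(set_nth false (bits xs) x true) size_set_nth szb.
  exact: (maxn_idPr x36).
apply: (@eq_from_nth _ false) => [|i]; first by rewrite szb size_set_bits.
rewrite szb => lti; rewrite nth_bits.
by rewrite -[i]/(val (Ordinal lti)) nth_set_bits inE.
Qed.

Lemma block_point_set b : all (fun n => n.-1 < 36) b -> block b = point_set (map predn b).
Proof.
move=> b36; apply/setP=> i; rewrite !inE; apply/mapP/mapP=> -[n bn Ei]; exists n => //.
  by rewrite Ei [LHS]val_pt // (allP b36).
by apply: val_inj; rewrite [RHS]val_pt // (allP b36).
Qed.

Lemma perm_point_set (s : {perm 'I_36}) xs : all (gtn 36) xs ->
  s @: point_set xs = point_set (map (nth 0 (ptab s)) xs).
Proof.
move=> xs36; apply/setP=> i; rewrite inE; apply/imsetP/mapP=> [[j]|[x xs_x Ex]].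
  by rewrite inE => xs_j ->; exists (val j); rewrite ?nth_ptab.
have x36 : x < 36 := allP xs36 x xs_x.
exists (Ordinal x36); rewrite ?inE //; apply: val_inj.
by rewrite Ex -[x]/(val (Ordinal x36)) nth_ptab.
Qed.

Lemma perm_tab_bound (s : {perm 'I_36}) xs : all (gtn 36) xs ->
  all (gtn 36) (map (nth 0 (ptab s)) xs).
Proof.
move=> xs36; apply/allP=> _ /mapP[x xs_x ->]; have x36 : x < 36 := allP xs36 x xs_x.
by rewrite -[x]/(val (Ordinal x36)) nth_ptab /=.
Qed.

(** For a list [L] of tables, [nth [::] (nth [::] (buckets L) x) y] is the list of those
    that send [x] to 0 and [y] to 1. *)
Definition buckets (L : seq (seq nat)) : seq (seq (seq (seq nat))) :=
  [seq let Lx := [seq t <- L | nth 0 t x == 0] in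
       [seq [seq t <- Lx | nth 0 t y == 1] | y <- tid] | x <- tid].

Lemma buckets_nth L x y : x < 36 -> y < 36 ->
  nth [::] (nth [::] (buckets L) x) y =
    [seq t <- L | (nth 0 t y == 1) && (nth 0 t x == 0)].
Proof.
move=> x36 y36; rewrite (nth_map 0) ?size_iota // nth_iota // (nth_map 0) ?size_iota //.
by rewrite nth_iota // filter_predI.
Qed.

(** The characteristic sequences of the images of [xs] that contain the points 0 and 1,
    under the tables arranged in [E]. *)
Definition images (E : seq (seq (seq (seq nat)))) (xs : seq nat) : seq bitseq :=
  flatten [seq [seq bits (map (nth 0 t) xs) | t <- nth [::] (nth [::] E xy.1) xy.2]
             | xy <- [seq (x, y) | x <- xs, y <- xs]].

Section Images.

Variables (H : {group {perm 'I_36}}) (L : seq (seq nat)).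
Hypothesis HL : {in H, forall s, ptab s \in L}.
Hypothesis LH : forall t, t \in L -> exists2 s, s \in H & ptab s = t.

Let p0 : 'I_36 := ord0.
Let p1 : 'I_36 := inord 1.

Lemma val_p1 : val p1 = 1. Proof. by rewrite /p1 /= inordK. Qed.

Lemma imagesP xs m : all (gtn 36) xs ->
  reflect (exists2 s, s \in H &
             [/\ p0 \in s @: point_set xs, p1 \in s @: point_set xs
               & m = set_bits (s @: point_set xs)])
          (m \in images (buckets L) xs).
Proof.
move=> xs36; apply: (iffP flatten_mapP) => [[_ /allpairsP[[x y] /= [xs_x xs_y ->]]]|].
  have [x36 y36] : x < 36 /\ y < 36 := conj (allP xs36 _ xs_x) (allP xs36 _ xs_y).
  rewrite /= buckets_nth //.
  case/mapP=> t; rewrite mem_filter -andbA => /and3P[/eqP ty /eqP tx /LH[s Hs Et]] ->.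
  exists s => //; rewrite perm_point_set // Et bits_point_set -?Et ?perm_tab_bound //.
  rewrite !inE Et val_p1; split=> //; apply/mapP.
    by exists x; rewrite ?tx.
  by exists y; rewrite ?ty.
case=> s Hs []; rewrite perm_point_set // !inE val_p1.
case/mapP=> x xs_x Ex /mapP[y xs_y Ey] ->.
exists (x, y); first exact: allpairs_f.
have [x36 y36] : x < 36 /\ y < 36 := conj (allP xs36 _ xs_x) (allP xs36 _ xs_y).
rewrite /= buckets_nth //.
apply/mapP; exists (ptab s).
  by rewrite mem_filter -Ex -Ey !eqxx HL.
by rewrite bits_point_set // perm_tab_bound.
Qed.

(** The blocks through the points 0 and 1, counted among the images of one of them. *)
Lemma images_lambda lambda B xs :
    design 36 6 lambda B -> block_transitive H B -> all (gtn 36) xs -> point_set xs \in B ->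
  lambda = size (undup (images (buckets L) xs)).
Proof.
move=> [_ _ lamB] trB xs36 Bxs.
have p01 : #|[set p0; p1]| = 2 by rewrite cards2 -val_eqE /= inordK.
rewrite -(lamB _ p01) cardE -(size_map set_bits).
apply: perm_size; apply: uniq_perm; rewrite ?undup_uniq //.
  by rewrite (map_inj_uniq set_bits_inj) enum_uniq.
move=> m; rewrite mem_undup; apply/mapP/(imagesP m xs36) => [[c]|[s Hs [s0 s1 ->]]].
  rewrite mem_enum inE subUset !sub1set => /and3P[Bc c0 c1] ->.
  by have [s Hs Ec] := block_transitive_image trB Bxs Bc; exists s; rewrite -?Ec.
exists (s @: point_set xs); rewrite // mem_enum inE subUset !sub1set s0 s1 !andbT.
by rewrite (block_transitive_orbit trB Bxs); apply/orbitP; exists s.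
Qed.

End Images.

(** * The base blocks and the checks *)

(** A weight on pairs of points that is invariant under [K2], from its values [w0] on the
    pairs that contain 0: the row of [x] is read off from an element of [K2] that sends
    [x] to 0. *)
Definition weight_table (w0 : seq nat) : seq (seq nat) :=
  [seq let v := head [::] [seq t <- K2_tabs | nth 0 t x == 0] in
    [seq nth 0 w0 (nth 0 v y) | y <- tid] | x <- tid].

(** The list numbers the orbits on the other points of the stabiliser of 0 in [K2]; they
    have lengths 7, 14, 7 and 7, and [ws] gives the weight of each.  Since the three
    orbits of length 7 are fused in [H2], the weight [W_II] is invariant under [H2].  On a
    block of a design with group [K2] the numbers of pairs of the four kinds are 3, 6, 3
    and 3, and the values of [W_I] are such that no set of six points that contains 0 and
    1 has the same total with other numbers of pairs. *)
Definition orbital_weights (ws : seq nat) : seq nat :=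
  [seq nth 0 ws i | i <-
   [:: 0; 1; 2; 2; 3; 4; 2; 2; 4; 1; 3; 1; 2; 2; 2; 4; 3; 4; 2; 3; 3; 1; 2; 2; 1; 3; 4;
       2; 2; 1; 2; 4; 2; 1; 4; 3]].
Definition W_I := weight_table (orbital_weights [:: 0; 10; 0; 2; 13]).
Definition W_II := weight_table (orbital_weights [:: 0; 0; 1; 0; 0]).

(** A permutation that conjugates [g1] to [h1] and [g2] to [h2], hence [H1] to [K2]. *)
Definition kappa : {perm 'I_36} := perm_of_cycles
 [:: [:: 1; 32; 15; 11; 29; 34; 14; 9; 13; 33; 18; 27; 6; 24; 19; 21; 20; 30;
         12; 28; 4; 25; 2; 36; 23; 17; 7; 22; 16];
    [:: 3; 35; 5; 31; 8; 26]].
Definition kappa_tab : seq nat := cycles_tab ltac:(cycles_of kappa).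

(** The base blocks as lists of numbers from 0; those of the first list are moved by
    [kappa] to base blocks for [K2]. *)
Definition reps_I : seq (nat * seq nat) :=
  [seq (lb.1, map (nth 0 kappa_tab) (map predn lb.2)) | lb <- list_I].
Definition reps_II : seq (nat * seq nat) := [seq (lb.1, map predn lb.2) | lb <- list_II].

(** [lambda] is the number of blocks through the points 0 and 1. *)
Definition lambda_check (L : seq (seq nat)) (reps : seq (nat * seq nat)) : bool :=
  let E := buckets L in all (fun lb => size (undup (images E lb.2)) == lb.1) reps.

Definition weight_invariant (W : seq (seq nat)) (t : seq nat) : bool :=
  all (fun x => all (fun y =>
     nth 0 (nth [::] W (nth 0 t x)) (nth 0 t y) == nth 0 (nth [::] W x) y) tid) tid.

Lemma lambda_check_I : lambda_check K2_tabs reps_I. Proof. by vm_compute. Qed.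
Lemma lambda_check_II : lambda_check H2_tabs reps_II. Proof. by vm_compute. Qed.
(** Every set of six points that contains 0 and 1 and has the right weight is an image of
    a base block. *)
Lemma exhaust_check_I : let E := buckets H2_tabs in
  exhaust W_I 75 36 2 6 0 0 [::] (flatten [seq images E lb.2 | lb <- reps_I]).
Proof. by vm_compute. Qed.
Lemma exhaust_check_II : let E := buckets H2_tabs in
  exhaust W_II 6 36 2 6 0 0 [::] (flatten [seq images E lb.2 | lb <- reps_II]).
Proof. by vm_compute. Qed.

(** * Transport of designs *)

Section Transport.

Variables (T T' : finType) (f : T' -> T).
Variables (G : {group {perm T}}) (H : {group {perm T'}}).
Hypothesis bij_f : bijective f.
Hypothesis GH : forall g : {perm T}, g \in G ->
  exists2 h : {perm T'}, h \in H & forall i, f (h i) = g (f i).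
Hypothesis HG : forall h : {perm T'}, h \in H ->
  exists2 g : {perm T}, g \in G & forall i, f (h i) = g (f i).

(** The structure on [T'] that [f] carries to [B]. *)
Definition preim_design (B : {set {set T}}) : {set {set T'}} :=
  [set c : {set T'} | f @: c \in B].

Lemma imset_bij (b : {set T}) : exists c : {set T'}, b = f @: c.
Proof.
case: bij_f => f' fK f'K; exists (f' @: b).
by rewrite -imset_comp (eq_imset _ f'K) imset_id.
Qed.

Lemma imset_perm_comp (h : {perm T'}) (g : {perm T}) (c : {set T'}) :
  (forall i, f (h i) = g (f i)) -> f @: (h @: c) = g @: (f @: c).
Proof. by move=> fhg; rewrite -!imset_comp; apply: eq_imset => i /=. Qed.

Lemma preim_designK B : [set f @: (c : {set T'}) | c in preim_design B] = B.
Proof.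
apply/setP=> b; apply/imsetP/idP=> [[c + ->]|Bb]; first by rewrite inE.
by have [c Ec] := imset_bij b; exists c; rewrite // inE -Ec.
Qed.

Lemma preim_designP v k lambda B : design v k lambda B -> design v k lambda (preim_design B).
Proof.
have injf := bij_inj bij_f; case=> cT cB lamB; split.
- by rewrite (bij_eq_card bij_f).
- by move=> c; rewrite inE => /cB; rewrite card_imset.
move=> S cS; have cfS : #|f @: S| = 2 by rewrite card_imset.
rewrite -(lamB _ cfS) -(card_imset _ (imset_inj injf)); apply: eq_card => b.
apply/imsetP/idP=> [[c]|].
  by rewrite !inE => /andP[Bc sSc] ->; rewrite Bc imsetS.
have [c ->] := imset_bij b; rewrite inE => /andP[Bc /subsetP sSc].
exists c; rewrite // !inE Bc; apply/subsetP=> i Si.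
by rewrite -(mem_imset _ _ injf) sSc // imset_f.
Qed.

Lemma preim_block_transitive B : block_transitive G B -> block_transitive H (preim_design B).
Proof.
move=> trB; have injf := bij_inj bij_f.
have [b Bb] := block_exists trB; have [c Ec] := imset_bij b.
have Bc : c \in preim_design B by rewrite inE -Ec.
apply/imsetP; exists c => //; apply/setP=> d; rewrite inE.
apply/idP/orbitP=> [Bd|[h /HG[g Gg fhg] <-]].
  have [g /GH[h Hh fhg] Ed] := block_transitive_image trB Bb Bd.
  exists h => //; apply: (imset_inj injf).
  by rewrite Ed Ec -(imset_perm_comp _ fhg).
rewrite -[_ \in B]/(f @: (h @: c) \in B) (imset_perm_comp _ fhg) -Ec.
by rewrite (block_transitive_orbit trB Bb); apply/orbitP; exists g.
Qed.

End Transport.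

(** * Classification on the points 1, ..., 36 *)

Local Open Scope group_scope.

Lemma mask_set_bits (X : {set 'I_36}) : mask (set_bits X) tid = [seq val i | i <- enum X].
Proof.
rewrite /tid -val_enum_ord -map_mask /set_bits -filter_mask; congr (map _ _).
by rewrite enumT [RHS]/enum_mem.
Qed.

(** The classification for a group [H] normalised by [H2], from the results of the
    checks; [L] is the list of tables of [H]. *)
Section Classification.

Variables (H : {group {perm 'I_36}}) (L : seq (seq nat)).
Variables (W : seq (seq nat)) (tgt : nat) (reps : seq (nat * seq nat)).
Hypothesis HL : {in H, forall s, ptab s \in L}.
Hypothesis LH : forall t, t \in L -> exists2 s, s \in H & ptab s = t.
Hypothesis nH : H2 \subset 'N(H).
Hypothesis WH : {in H, forall s : {perm 'I_36}, forall i j : 'I_36,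
  nth 0 (nth [::] W (s i)) (s j) = nth 0 (nth [::] W i) j}.
Hypothesis symW : {in tid &, forall x y, nth 0 (nth [::] W x) y = nth 0 (nth [::] W y) x}.
Hypothesis totW : chain_weight W [::] tid = (42 * tgt)%N.
Hypothesis reps36 : all (fun lb => all (gtn 36) lb.2) reps.
Hypothesis lamP : lambda_check L reps.
Hypothesis exhP : exhaust W tgt 36 2 6 0 0 [::]
  (flatten [seq images (buckets H2_tabs) lb.2 | lb <- reps]).

Variables (B : {set {set 'I_36}}) (lambda : nat).
Hypotheses (desB : design 36 6 lambda B) (trB : block_transitive H B).

Lemma sum_enum (X : {set 'I_36}) (F : nat -> nat -> nat) :
  (\sum_(x <- map val (enum X)) \sum_(y <- map val (enum X) | y != x) F x y
    = \sum_(x in X) \sum_(y in X | y != x) F x y)%N.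
Proof.
rewrite big_map big_enum; apply: eq_bigr => x _ /=.
by rewrite big_map big_enum_cond.
Qed.

Lemma block_weight (X : {set 'I_36}) : X \in B ->
  chain_weight W [::] (mask (set_bits X) tid) = tgt.
Proof.
move=> BX.
have symX (Y : {set 'I_36}) : {in map val (enum Y) &, forall x y,
    nth 0 (nth [::] W x) y = nth 0 (nth [::] W y) x}.
  by move=> _ _ /mapP[i _ ->] /mapP[j _ ->]; apply: symW; rewrite mem_iota /=.
have sumE (Y : {set 'I_36}) :
    (\sum_(x in Y) \sum_(y in Y | y != x) nth 0 (nth [::] W x) y
      = (chain_weight W [::] (mask (set_bits Y) tid)).*2)%N.
  rewrite mask_set_bits -chain_weight_sum //; first by rewrite sum_enum.
  by rewrite (map_inj_uniq val_inj) enum_uniq.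
have := design36_weight (w := fun x y : 'I_36 => nth 0 (nth [::] W x) y) desB trB _ BX.
rewrite sumE; have := sumE [set: 'I_36].
under eq_bigl do rewrite in_setT.
under eq_bigr do under eq_bigl do rewrite in_setT.
move=> ->; rewrite (mask_set_bits [set: 'I_36]) enum_setT -enumT val_enum_ord totW.
by move=> /(_ (fun s Hs x y => WH Hs x y)); lia.
Qed.

Lemma block_in_reps (X : {set 'I_36}) : X \in B -> ord0 \in X -> inord 1 \in X ->
  exists2 lb, lb \in reps & exists2 n, n \in H2 & X = n @: point_set lb.2.
Proof.
move=> BX X0 X1; have [_ cB _] := desB.
have H2L s : s \in H2 -> ptab s \in H2_tabs by apply: mem_H2.
have imP lb : lb \in reps -> all (gtn 36) lb.2 by apply: (allP reps36).
have : set_bits X \in flatten [seq images (buckets H2_tabs) lb.2 | lb <- reps].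
  apply: (exhaust_sound exhP (size_set_bits X)).
  - apply/(all_nthP false) => i; rewrite size_take size_set_bits /= => lti.
    rewrite nth_take //; case: i lti => [|[|//]] _; first by rewrite (nth_set_bits X ord0).
    by have := nth_set_bits X (inord 1); rewrite inordK // X1.
  - transitivity #|X|; last exact: cB.
    by rewrite count_map cardE -size_filter enumT; congr size; apply: eq_filter.
  - exact: block_weight.
  move=> m /flatten_mapP[lb /imP lb36 /(imagesP H2L H2_tabs_sub _ lb36)[s _ [_ _ ->]]].
  exact: size_set_bits.
case/flatten_mapP=> lb reps_lb; have lb36 := imP _ reps_lb.
case/(imagesP H2L H2_tabs_sub _ lb36)=> n Hn [_ _ /set_bits_inj EX].
by exists lb => //; exists n.
Qed.

(** Some block contains the points 0 and 1, because [lambda] is positive.  It is an image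
    under some [n] in [H2] of a base block, and [n] normalises [H]. *)
Lemma classification :
  exists2 lb, lb \in reps & lb.1 = lambda /\
    exists2 n : {perm 'I_36}, n \in H2 &
      B = [set n @: (c : {set 'I_36}) | c in orbit 'P^* H (point_set lb.2)].
Proof.
have [_ _ lamB] := desB.
have p01 : #|[set ord0; inord 1 : 'I_36]| = 2 by rewrite cards2 -val_eqE /= inordK.
have : 0 < #|[set b in B | [set ord0; inord 1] \subset b]|.
  by rewrite (lamB _ p01) (design_lambda_gt0 desB trB).
case/card_gt0P=> X; rewrite inE subUset !sub1set => /and3P[BX X0 X1].
have [lb reps_lb [n Hn EX]] := block_in_reps BX X0 X1.
exists lb => //; pose f : 'I_36 -> 'I_36 := n.
have bij_f : bijective f by exists n^-1; [apply: permK | apply: permKV].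
have HH g : g \in H -> exists2 h : {perm 'I_36}, h \in H & forall i, f (h i) = g (f i).
  move=> Hg; exists (g ^ n^-1) => [|i].
    by rewrite memJ_norm // groupV (subsetP nH).
  by rewrite /f conjgE invgK !permM permKV.
have HH' h : h \in H -> exists2 g : {perm 'I_36}, g \in H & forall i, f (h i) = g (f i).
  move=> Hh; exists (h ^ n) => [|i]; first by rewrite memJ_norm // (subsetP nH).
  by rewrite /f permJ.
have desB0 := preim_designP bij_f desB.
have trB0 := preim_block_transitive bij_f HH HH' trB.
have B0lb : point_set lb.2 \in preim_design f B by rewrite inE -EX.
have lb36 := allP reps36 lb reps_lb.
split.
  rewrite (images_lambda HL LH desB0 trB0 lb36 B0lb).
  by rewrite (eqP (allP lamP lb reps_lb)).
by exists n => //; rewrite -(block_transitive_orbit trB0 B0lb) (preim_designK bij_f).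
Qed.

End Classification.

Lemma weight_invariant_gen (W : seq (seq nat)) (A : {set {perm 'I_36}}) :
    {in A, forall s, weight_invariant W (ptab s)} ->
  {in <<A>>, forall s : {perm 'I_36}, forall i j : 'I_36,
     nth 0%N (nth [::] W (s i)) (s j) = nth 0%N (nth [::] W i) j}.
Proof.
move=> AW s /gen_prodgP[n [c Ac ->]]; elim: n c Ac => [|n IHn] c Ac i j.
  by rewrite big_ord0 !perm1.
pose P := \prod_(k < n) c (widen_ord (leqnSn n) k).
have IH : nth 0%N (nth [::] W (P i)) (P j) = nth 0%N (nth [::] W i) j.
  by apply: IHn => k; apply: Ac.
rewrite big_ord_recr /= -/P !permM -IH.
have [i36 j36] : val (P i) \in tid /\ val (P j) \in tid by rewrite !mem_iota /=.
have /eqP := allP (allP (AW _ (Ac ord_max)) _ i36) _ j36.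
by rewrite !nth_ptab.
Qed.

Lemma W_I_sym : all (fun x => all (fun y =>
  nth 0%N (nth [::] W_I x) y == nth 0%N (nth [::] W_I y) x) tid) tid.
Proof. by vm_compute. Qed.
Lemma W_II_sym : all (fun x => all (fun y =>
  nth 0%N (nth [::] W_II x) y == nth 0%N (nth [::] W_II y) x) tid) tid.
Proof. by vm_compute. Qed.

Lemma K2_gen : K2 = <<[set h1; h2]>> :> {set _}.
Proof.
apply/eqP; rewrite eqEsubset !gen_subG; apply/andP; split; apply/subsetP=> s /set2P[] ->.
- have [Hh1 Hh2] : h1 \in <<[set h1; h2]>> /\ h2 \in <<[set h1; h2]>>.
    by split; apply: mem_gen; [apply: set21 | apply: set22].
  by rewrite /u2 /= !groupM ?group1.
- by apply: mem_gen; apply: set22.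
- exact: K2_h1.
by apply: mem_gen; apply: (set22 u2 u3).
Qed.

Definition g1_tab : seq nat := cycles_tab ltac:(cycles_of g1).
Definition g2_tab : seq nat := cycles_tab ltac:(cycles_of g2).
Lemma ptab_g1 : ptab g1 = g1_tab. Proof. exact: ptab_cycles. Qed.
Lemma ptab_g2 : ptab g2 = g2_tab. Proof. exact: ptab_cycles. Qed.
Lemma ptab_kappa : ptab kappa = kappa_tab. Proof. exact: ptab_cycles. Qed.

Lemma H1_kappa : H1 :^ kappa = K2.
Proof.
have g1k : g1 ^ kappa = h1.
  rewrite conjgE; apply: (canLR (mulKg kappa)); apply: ptab_inj.
  by rewrite (ptabM g1) (ptabM kappa) ptab_g1 ptab_h1 ptab_kappa; vm_compute.
have g2k : g2 ^ kappa = h2.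
  rewrite conjgE; apply: (canLR (mulKg kappa)); apply: ptab_inj.
  by rewrite (ptabM g2) (ptabM kappa) ptab_g2 ptab_h2 ptab_kappa; vm_compute.
rewrite K2_gen /= -genJ; congr <<_>>.
by rewrite conjUg !conjg_set1 g1k g2k.
Qed.

Lemma orbit_design_kappa b : all (fun n => n.-1 < 36) b ->
  orbit 'P^* K2 (point_set (map (nth 0%N kappa_tab) (map predn b)))
    = [set kappa @: (c : {set 'I_36}) | c in orbit_design H1 b].
Proof.
move=> b36; have b36' : all (gtn 36) (map predn b) by rewrite all_map.
rewrite -ptab_kappa -perm_point_set // -block_point_set // -H1_kappa.
apply/setP=> c; apply/orbitP/imsetP=> [[_ /imsetP[h Hh ->] <-]|[_ /orbitP[h Hh <-] ->]].
  exists (h @: block b); first by apply/orbitP; exists h.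
  by rewrite /= /setact -!imset_comp; apply: eq_imset => i; rewrite /= /aperm permJ.
exists (h ^ kappa); first by rewrite memJ_conjg.
by rewrite /= /setact -!imset_comp; apply: eq_imset => i; rewrite /= /aperm permJ.
Qed.

Lemma list_I_range :
  all (fun lb => (lb.1 \in [:: 2; 6; 12]) && all (fun n => n.-1 < 36) lb.2) list_I.
Proof. by vm_compute. Qed.
Lemma list_II_range :
  all (fun lb => (lb.1 \in [:: 2; 6; 9; 12; 18; 36]) && all (fun n => n.-1 < 36) lb.2) list_II.
Proof. by vm_compute. Qed.

Lemma K2_tabs_sub t : t \in K2_tabs -> exists2 s, s \in K2 & ptab s = t.
Proof. by rewrite K2_tabsE => /mapP[s]; rewrite -K2_list; exists s. Qed.

Lemma W_I_total : chain_weight W_I [::] tid = (42 * 75)%N. Proof. by vm_compute. Qed.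
Lemma W_II_total : chain_weight W_II [::] tid = (42 * 6)%N. Proof. by vm_compute. Qed.

Lemma all2_in (T : eqType) (s : seq T) (P : T -> T -> bool) :
  all (fun x => all (P x) s) s -> {in s &, forall x y, P x y}.
Proof. by move=> sP x y sx sy; have := allP (allP sP x sx) y sy. Qed.

Lemma W_I_K2 : {in K2, forall s : {perm 'I_36}, forall i j : 'I_36,
  nth 0%N (nth [::] W_I (s i)) (s j) = nth 0%N (nth [::] W_I i) j}.
Proof.
apply: weight_invariant_gen => s /set2P[] ->; rewrite ?ptab_u2 ?ptab_h2; by vm_compute.
Qed.

Lemma W_II_H2 : {in H2, forall s : {perm 'I_36}, forall i j : 'I_36,
  nth 0%N (nth [::] W_II (s i)) (s j) = nth 0%N (nth [::] W_II i) j}.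
Proof.
apply: weight_invariant_gen => s /setUP[/set2P[] ->|/set1P->].
- by rewrite ptab_h1; vm_compute.
- by rewrite ptab_h2; vm_compute.
by rewrite ptab_h3; vm_compute.
Qed.

Lemma perm_design_iso (T T' : finType) (f : T -> T') (B : {set {set T}}) :
  bijective f -> design_iso B [set f @: (c : {set T}) | c in B].
Proof. by exists f. Qed.

Lemma design_iso_trans (T T' T'' : finType) (B : {set {set T}}) (B' : {set {set T'}})
    (B'' : {set {set T''}}) :
  design_iso B B' -> design_iso B' B'' -> design_iso B B''.
Proof.
case=> f bij_f <- [g bij_g <-]; exists (g \o f); first exact: bij_comp.
by rewrite -imset_comp; apply: eq_imset => c /=; rewrite -imset_comp.
Qed.

Lemma K2_designs (B : {set {set 'I_36}}) lambda :
    design 36 6 lambda B -> block_transitive K2 B ->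
  exists2 b, (lambda, b) \in list_I & design_iso (orbit_design H1 b) B.
Proof.
move=> desB trB.
have HL : {in K2, forall s, ptab s \in K2_tabs} by move=> s; rewrite mem_K2.
have symW : {in tid &, forall x y,
    nth 0%N (nth [::] W_I x) y = nth 0%N (nth [::] W_I y) x}.
  by move=> x y tx ty; apply/eqP/(all2_in W_I_sym).
have reps36 : all (fun lb => all (gtn 36) lb.2) reps_I by vm_compute.
have [_ /mapP[[l b] Ilb ->] /= [<- [n _ EB]]] :=
  classification HL K2_tabs_sub (normal_norm K2_H2) W_I_K2 symW W_I_total reps36
    lambda_check_I exhaust_check_I desB trB.
exists b => //; rewrite EB; have /andP[_ b36] := allP list_I_range _ Ilb.
rewrite (orbit_design_kappa b36).
apply: design_iso_trans (perm_design_iso _ _) (perm_design_iso _ _).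
  by exists kappa^-1; [apply: permK | apply: permKV].
by exists n^-1; [apply: permK | apply: permKV].
Qed.

Lemma H2_designs (B : {set {set 'I_36}}) lambda :
    design 36 6 lambda B -> block_transitive H2 B ->
  exists2 b, (lambda, b) \in list_II & design_iso (orbit_design H2 b) B.
Proof.
move=> desB trB.
have HL : {in H2, forall s, ptab s \in H2_tabs} by move=> s; apply: mem_H2.
have symW : {in tid &, forall x y,
    nth 0%N (nth [::] W_II x) y = nth 0%N (nth [::] W_II y) x}.
  by move=> x y tx ty; apply/eqP/(all2_in W_II_sym).
have reps36 : all (fun lb => all (gtn 36) lb.2) reps_II by vm_compute.
have [_ /mapP[[l b] IIlb ->] /= [<- [n _ EB]]] :=
  classification HL H2_tabs_sub (normG H2) W_II_H2 symW W_II_total reps36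
    lambda_check_II exhaust_check_II desB trB.
exists b => //; rewrite EB; have /andP[_ b36] := allP list_II_range _ IIlb.
rewrite -block_point_set //; apply: perm_design_iso.
by exists n^-1; [apply: permK | apply: permKV].
Qed.

Lemma H2_trans : [transitive H2, on [set: 'I_36] | 'P].
Proof.
have := K2_trans => /imsetP[i _ Ei]; apply/imsetP; exists i; rewrite ?inE //.
apply/esym/eqP; rewrite -subTset Ei; apply: imsetS.
exact: normal_sub K2_H2.
Qed.

(** The isomorphism of [G] with [H] makes the two actions equivalent, and so carries the
    design over to ['I_36]. *)
Lemma transport_design (T : finType) (G : {group {perm T}}) (H : {group {perm 'I_36}})
    (q lambda : nat) (B : {set {set T}}) :
    design 36 6 lambda B -> block_transitive G B -> G \isog H ->
    [transitive H, on [set: 'I_36] | 'P] -> u7 \in H -> 0 < q < 7 ->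
    #|H| = (36 * (7 * q))%N ->
  exists2 B' : {set {set 'I_36}},
    design 36 6 lambda B' /\ block_transitive H B' & design_iso B' B.
Proof.
move=> desB trB /isogP[phi injphi imphi] trH Hu7 q7 oH; have [cT _ _] := desB.
have [i0 fix7] := u7_fix.
have cT36 : #|T| = #|'I_36| by rewrite card_ord.
have oG : #|G| = (#|T| * (7 * q))%N by rewrite cT -oH -imphi card_injm.
have n7 : ~~ (7 %| #|T|) by rewrite cT.
have [f bij_f f_phi] := equivariant_bijection injphi imphi
  (design36_transitive desB trB) trH (isT : prime 7) q7 cT36 oG n7 Hu7 u7_order fix7.
have GH g : g \in G -> exists2 h : {perm 'I_36}, h \in H & forall i, f (h i) = g (f i).
  by move=> Gg; exists (phi g); [rewrite -imphi mem_morphim | apply: f_phi].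
have HG h : h \in H -> exists2 g : {perm T}, g \in G & forall i, f (h i) = g (f i).
  by rewrite -imphi => /morphimP[g _ Gg ->]; exists g => //; apply: f_phi.
exists (preim_design f B).
  by split; [apply: preim_designP | apply: preim_block_transitive GH HG _ _].
by rewrite -[X in design_iso _ X](preim_designK bij_f); apply: perm_design_iso.
Qed.

Local Close Scope group_scope.

Theorem theorem1p2
  (F : finFieldType) (cardF : #|F| = 8)
  (T : finType) (lambda : nat) (B : {set {set T}})
  (desB : nontrivial_design 36 6 lambda B)
  (G : {group {perm T}}) (sGA : G \subset Aut_design B)
  (trG : block_transitive G B)
  (iota : {morphism G >-> {perm coset_of 'Z(SL2 F)}}) (inj_iota : ('injm iota)%g)
  (nPSL : (PSL2_in_PGammaL2 F <| iota @* G)%g)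
  (sGPGammaL : (iota @* G)%g \subset PGammaL2 F) :
  [/\ (iota @* G)%g = PSL2_in_PGammaL2 F,
      lambda \in [:: 2; 6; 12]
    & exists2 b : seq nat,
        (lambda, b) \in list_I & design_iso (orbit_design H1 b) B]
  \/
  [/\ (iota @* G)%g = PGammaL2 F,
      lambda \in [:: 2; 6; 9; 12; 18; 36]
    & exists2 b : seq nat,
        (lambda, b) \in list_II & design_iso (orbit_design H2 b) B].
Proof.
have [desB36 _] := desB.
have isoG : G \isog (iota @* G)%G by apply/isogP; exists iota.
have K2u7 : u7 \in K2 by apply: groupM; apply: mem_gen; [apply: set21 | apply: set22].
have [EJ|EJ] := PSL2_PGammaL2_cases cardF (J := (iota @* G)%G) (normal_sub nPSL) sGPGammaL.
  have isoK : G \isog K2.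
    by apply: isog_trans isoG _; rewrite isog_sym EJ; apply: K2_isog_Inn.
  have [B' [desB' trB'] isoB] :=
    transport_design (q := 2) desB36 trG isoK K2_trans K2u7 isT card_K2.
  have [b Ib iso_b] := K2_designs desB' trB'.
  left; split; first exact: EJ.
    by have /andP[] := allP list_I_range _ Ib.
  by exists b => //; apply: design_iso_trans iso_b isoB.
have isoH : G \isog H2.
  by apply: isog_trans isoG _; rewrite isog_sym EJ; apply: H2_isog_PGammaL2.
have H2u7 : u7 \in H2 by apply: (subsetP (normal_sub K2_H2)).
have [B' [desB' trB'] isoB] :=
  transport_design (q := 6) desB36 trG isoH H2_trans H2u7 isT card_H2.
have [b IIb iso_b] := H2_designs desB' trB'.
right; split; first exact: EJ.
  by have /andP[] := allP list_II_range _ IIb.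
by exists b => //; apply: design_iso_trans iso_b isoB.
Qed.
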